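(* Let $1\le r\le p\le q$ be integers, and suppose one of the following holds: (a) $\chi(\theta_{r,p,q})=3$ and $r+p+q-1\in\{2k+1,2k+2\}$ for some integer $k\ge 2$; (b) $\chi(\theta_{r,p,q})=2$ and $r+p+q-1\in\{2k+2,2k+3\}$ for some integer $k\ge 1$. Then for all sufficiently large $m$, if $G$ is a $\theta_{r,p,q}$-free graph with $m$ edges, then $\lambda(G)\le\lambda(S_{k,m})$, with equality if and only if $G=S_{k,m}$.
   Context: All graphs are finite and simple; isolated vertices are ignored. $\theta_{r,p,q}$ is the theta graph formed by three internally disjoint paths of lengths $r,p,q$ sharing a common pair of endpoints. Split graph: for $1\le k<m$, write $m-\binom{k}{2}=kt+s$ with integers $t\ge1$ and $0\le s\le k-1$; $S_{k,m}$ is the $m$-edge graph obtained from $K_k\vee tK_1$ (a clique $K_k$ joined to $t$ independent vertices) by adding one extra vertex adjacent to exactly $s$ vertices of the $K_k$. $\lambda(G)$ is the spectral radius of the adjacency matrix; $F$-free means no subgraph isomorphic to $F$; $\chi$ is the chromatic number. *)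

(* Defs.v *)
From HB Require Import structures.
From mathcomp Require Import all_boot all_order all_algebra.
From mathcomp Require Import algC.
Set Implicit Arguments. Unset Strict Implicit. Unset Printing Implicit Defensive.
Import Order.TTheory GRing.Theory Num.Theory.

Definition simple_graph (n : nat) (e : rel 'I_n) : Prop :=
  symmetric e /\ irreflexive e.

Definition nedges (n : nat) (e : rel 'I_n) : nat :=
  #|[set pq : 'I_n * 'I_n | e pq.1 pq.2]| %/ 2.

Definition subgraph_of (a n : nat) (F : rel 'I_a) (G : rel 'I_n) : Prop :=
  exists f : 'I_a -> 'I_n, injective f /\ forall x y, F x y -> G (f x) (f y).

Definition free_of (a n : nat) (F : rel 'I_a) (G : rel 'I_n) : Prop :=
  ~ subgraph_of F G.

Definition colorable (n : nat) (e : rel 'I_n) (k : nat) : Prop :=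
  exists c : 'I_n -> 'I_k, forall x y, e x y -> c x != c y.

Definition chromatic_number (n : nat) (e : rel 'I_n) (k : nat) : Prop :=
  colorable e k /\ forall j, j < k -> ~ colorable e j.

Definition consec (s : seq nat) (x y : nat) : bool :=
  has (fun i => (nth 0 s i == x) && (nth 0 s i.+1 == y)) (iota 0 (size s).-1).

(* Theta graph theta_{r,p,q} on r+p+q-1 vertices: vertex 0 and vertex 1 are
   the two common endpoints; the three paths are
     0, 2, 3, ..., r, 1                   (length r)
     0, r+1, ..., r+p-1, 1                (length p)
     0, r+p, ..., r+p+q-2, 1              (length q). *)
Definition theta_paths (r p q : nat) : seq (seq nat) :=
  [:: 0 :: rcons (iota 2 r.-1) 1;
      0 :: rcons (iota r.+1 p.-1) 1;
      0 :: rcons (iota (r + p) q.-1) 1].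

Definition theta (r p q : nat) : rel 'I_(r + p + q - 1) :=
  fun x y => (x != y) &&
    has (fun s => consec s x y || consec s y x) (theta_paths r p q).

Arguments theta : clear implicits.

(* Split graph S_{k,m}: m - C(k,2) = k t + s, 0 <= s < k.  Vertices:
   0..k-1 the clique K_k, k..k+t-1 the t independent vertices joined to the
   whole clique, k+t the extra vertex adjacent to the clique vertices 0..s-1. *)
Definition split_t (k m : nat) : nat := (m - 'C(k, 2)) %/ k.
Definition split_s (k m : nat) : nat := (m - 'C(k, 2)) %% k.

Definition split_graph (k m : nat) : rel 'I_(k + split_t k m + 1) :=
  fun x y =>
    let t := split_t k m in let s := split_s k m in
    let adj (a b : nat) :=
      [|| (a < k) && (b < k),
          (a < k) && (k <= b < k + t)
        | (b == k + t) && (a < s)] in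
    (x != y) && (adj x y || adj y x).

Arguments split_graph : clear implicits.

Definition nonisolated (n : nat) (e : rel 'I_n) (x : 'I_n) : bool :=
  [exists y, e x y].

Definition iso_up_to_isolated (n1 n2 : nat) (e1 : rel 'I_n1) (e2 : rel 'I_n2)
  : Prop :=
  exists f : 'I_n1 -> 'I_n2,
    [/\ {in nonisolated e1 &, injective f},
        {in nonisolated e1, forall x, nonisolated e2 (f x)},
        (forall y, nonisolated e2 y -> exists2 x, nonisolated e1 x & f x = y)
      & {in nonisolated e1 &, forall x y, e1 x y = e2 (f x) (f y)}].

Definition adjmx (n : nat) (e : rel 'I_n) : 'M[algC]_n :=
  (\matrix_(i, j) (e i j)%:R)%R.

(* spectral radius: the largest modulus of an eigenvalue, i.e. of a root of
   the characteristic polynomial (listed with multiplicity). *)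
Definition spectral_radius (n : nat) (A : 'M[algC]_n) : algC :=
  (\big[Num.max/0]_(z <- sval (closed_field_poly_normal (char_poly A))) `|z|)%R.

Definition lambda (n : nat) (e : rel 'I_n) : algC := spectral_radius (adjmx e).

(* Main.v *)
Require Import Defs.
From HB Require Import structures.
From mathcomp Require Import all_boot all_order all_algebra.
From mathcomp Require Import algC spectral.
From mathcomp Require Import zify ring lra.
Set Implicit Arguments. Unset Strict Implicit. Unset Printing Implicit Defensive.
Import Order.TTheory GRing.Theory Num.Theory.

(** Let [lam] be the spectral radius of a theta-free graph [G] with [m] edges and
    assume that it is at least that of the split graph, so that
    [lam ^ 2 >= m + (k - 1) * lam - O(1)].  Normalise a Perron vector [x] to have
    maximum [1], attained at [u], and let [N] be the neighbourhood of [u] and [W]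
    the set of vertices at distance at least two.  Counting walks of length two
    from [u] gives [lam ^ 2 - m = gain - loss], where the gain is the sum of
    [(x v + x w - 1)_+] over the edges inside [N] and the loss is a sum of
    nonnegative terms penalising all the edges which do not look like the edges
    of the split graph.  The graph induced on [N] contains no spider, hence is
    degenerate, and therefore [gain = O(lam)] and [loss = O(lam)].

    Call a vertex a hub if its neighbourhood carries almost all the weight of [x]
    on [N].  If there were [k + 1] hubs then [G] would contain a theta graph, or
    else almost no edge inside [N], which makes the gain too small.  The bound on
    the loss shows that only boundedly many vertices have entries away from [0],
    so that the gain is at most the number of hubs in [N] times [lam], plus
    [O(1)].  Hence there are exactly [k] hubs, their entries are close to [1],
    and all the other entries are close to [0].

    Finally move the entries of [x] on the hubs to the clique of the split graph
    and extend them by the eigenvalue equation.  Comparing Rayleigh quotients,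
    the difference is governed by the sum of the squares of the numbers of hubs
    adjacent to the other vertices; this is maximal only for the split graph, and
    the integrality gap absorbs the errors. *)

(** * Embeddings of theta graphs *)

(* Edges, oriented from 0 to 1, of a path of length [l] from 0 to 1 with internal
   vertices [s], [s + 1], ..., [s + l - 2]. *)
Definition arm_edge (s l x y : nat) : bool :=
  [|| [&& l == 1, x == 0 & y == 1], [&& 1 < l, x == 0 & y == s],
      [&& 1 < l, x == s + l - 2 & y == 1] | [&& s <= x, y == x.+1 & y < s + l - 1]].

Definition theta_edge (r p q x y : nat) : bool :=
  [|| arm_edge 2 r x y, arm_edge r.+1 p x y | arm_edge (r + p) q x y].

(** Replaces membership of a pair in a list of consecutive vertices by linear arithmetic on labels,
    so that later case analyses can be left to [lia]. *)
Lemma consec_arm s l x y : 0 < l ->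
  consec (0 :: rcons (iota s l.-1) 1) x y = arm_edge s l x y.
Proof.
move=> l0; rewrite /consec; set L := 0 :: _.
have -> : (size L).-1 = l by rewrite /= size_rcons size_iota prednK.
have nthE i : i <= l -> nth 0 L i =
    if i == 0 then 0 else if i < l then s + i - 1 else 1.
  case: i => [|i] //= il; rewrite nth_rcons size_iota.
  case: ltnP => h; first by rewrite nth_iota //; case: ltnP; lia.
  by case: eqP => h2; case: ltnP; lia.
apply/hasP/idP => [[i]|].
  rewrite mem_iota add0n => /andP[_ il]; rewrite !nthE; [|lia..].
  by rewrite /arm_edge; do ?case: ifP; lia.
move=> h; have [i il hi] : exists2 i, i < l &
    ((if i == 0 then 0 else if i < l then s + i - 1 else 1) == x) &&
    ((if i.+1 == 0 then 0 else if i.+1 < l then s + i.+1 - 1 else 1) == y).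
  move: h; rewrite /arm_edge => /or4P[] /and3P[] h1 h2 h3.
  - by exists 0 => /=; [lia|]; do ?case: ifP; lia.
  - by exists 0 => /=; [lia|]; do ?case: ifP; lia.
  - by exists l.-1; [lia|]; do ?case: ifP; lia.
  - by exists (x - s).+1; [lia|]; do ?case: ifP; lia.
by exists i; rewrite ?mem_iota // !nthE //; lia.
Qed.

Lemma thetaE r p q (x y : 'I_(r + p + q - 1)) : 0 < r -> 0 < p -> 0 < q ->
  theta r p q x y = (x != y) && (theta_edge r p q x y || theta_edge r p q y x).
Proof.
move=> r0 p0 q0; rewrite /theta; congr (_ && _).
rewrite /theta_paths /has (consec_arm 2 _ _ r0) (consec_arm r.+1 _ _ p0).
rewrite (consec_arm (r + p) _ _ q0) (consec_arm 2 _ _ r0) (consec_arm r.+1 _ _ p0).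
rewrite (consec_arm (r + p) _ _ q0) /theta_edge orbF.
move: (arm_edge _ _ x y) (arm_edge _ _ x y) (arm_edge _ _ x y) => [] [] [] //=; first by rewrite !orbT.
all: by rewrite ?orbT.
Qed.

Lemma theta_edge_lt r p q x y : 0 < r -> 0 < p -> 0 < q -> 1 < r + p + q - 1 ->
  theta_edge r p q x y -> [/\ x < r + p + q - 1, y < r + p + q - 1 & x != y].
Proof.
rewrite /theta_edge /arm_edge => r0 p0 q0 h1 h.
by case/or3P: h => /or4P[]/and3P[] a b c; split; lia.
Qed.

(** An embedding given on natural-number labels, constrained only below the number of vertices. Each
    edge is required in one orientation; symmetry of [e] supplies the other. *)
Definition contains_theta (T : eqType) (e : rel T) (r p q : nat) : Prop :=
  exists f : nat -> T, {in gtn (r + p + q - 1) &, injective f} /\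
    forall x y, theta_edge r p q x y -> e (f x) (f y).

Lemma contains_theta_subgraph n (G : rel 'I_n) r p q :
    0 < r -> 0 < p -> 0 < q -> symmetric G ->
  contains_theta G r p q -> subgraph_of (theta r p q) G.
Proof.
move=> r0 p0 q0 symG [f [finj fE]]; exists (fun i => f i); split.
  by move=> i j /finj/val_inj; apply; rewrite inE.
move=> x y; rewrite thetaE // => /andP[_ /orP[]] /fE //.
by rewrite symG.
Qed.

(** The relabelling [s] exchanges the internal vertices of the first two arms. Together with the
    exchange of the last two, it allows two arms of equal parity to be put first. *)
Lemma contains_theta_swap12 (T : eqType) (e : rel T) r p q : 0 < r -> 0 < p -> 0 < q ->
  contains_theta e r p q -> contains_theta e p r q.
Proof.
move=> r0 p0 q0 [f [finj fE]].
pose s i := if i < 2 then i else if i <= p then i + r - 1 else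
            if i < p + r then i - (p - 1) else i.
exists (fun i => f (s i)); split => [i j|x y h].
  rewrite !inE => hi hj /finj; rewrite !inE.
  have hs k : k < p + r + q - 1 -> s k < r + p + q - 1 by rewrite /s; do ?case: ifP; lia.
  by move=> /(_ (hs _ hi) (hs _ hj)); rewrite /s; do ?case: ifP; lia.
apply: fE; case/or3P: h => h; apply/or3P; [apply: Or32|apply: Or31|apply: Or33].
all: case/or4P: h => /and3P[a b c]; apply/or4P;
  [apply: Or41|apply: Or42|apply: Or43|apply: Or44];
  by apply/and3P; split; rewrite /s; do ?case: ifP; lia.
Qed.

Lemma contains_theta_swap23 (T : eqType) (e : rel T) r p q : 0 < r -> 0 < p -> 0 < q ->
  contains_theta e r p q -> contains_theta e r q p.
Proof.
move=> r0 p0 q0 [f [finj fE]].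
pose s i := if i <= r then i else if i < r + q then i + p - 1 else i - (q - 1).
exists (fun i => f (s i)); split => [i j|x y h].
  rewrite !inE => hi hj /finj; rewrite !inE.
  have hs k : k < r + q + p - 1 -> s k < r + p + q - 1 by rewrite /s; do ?case: ifP; lia.
  by move=> /(_ (hs _ hi) (hs _ hj)); rewrite /s; do ?case: ifP; lia.
apply: fE; case/or3P: h => h; apply/or3P; [apply: Or31|apply: Or33|apply: Or32].
all: case/or4P: h => /and3P[a b c]; apply/or4P;
  [apply: Or41|apply: Or42|apply: Or43|apply: Or44];
  by apply/and3P; split; rewrite /s; do ?case: ifP; lia.
Qed.

(** * Two-colourings and parities of the arms *)

Lemma theta_edge_theta r p q x y : 0 < r -> 0 < p -> 0 < q -> 1 < r + p + q - 1 ->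
  theta_edge r p q x y ->
  exists i j : 'I_(r + p + q - 1), [/\ val i = x, val j = y & theta r p q i j].
Proof.
move=> r0 p0 q0 n1 h; have [hx hy xy] := theta_edge_lt r0 p0 q0 n1 h.
by exists (Ordinal hx), (Ordinal hy); rewrite thetaE //= -val_eqE /= xy h.
Qed.

(** Internal labels are consecutive, so a colouring by shifted parity alternates between them and
    only the two ends need checking. The last internal label is [s + l - 2], which has the parity of
    [s + l]. *)
Lemma arm_alternates (col : nat -> bool) b s l x y : 0 < l ->
    (forall i, s <= i -> i < s + l - 1 -> col i = b (+) odd i) ->
    (l = 1 -> col 0 != col 1) ->
    (1 < l -> col 0 != b (+) odd s /\ col 1 != b (+) odd s (+) odd l) ->
  arm_edge s l x y -> col x != col y.
Proof.
move=> l0 inner one many; rewrite /arm_edge => /or4P[/and3P[l1 /eqP-> /eqP->]|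
  /and3P[l1 /eqP-> /eqP->]|/and3P[l1 /eqP xE /eqP->]|/and3P[sx /eqP-> ys]].
- exact/one/eqP.
- by have [] := many l1; rewrite (inner s) //; clear - l1; lia.
- have [_] := many l1; have x2 : x.+2 = s + l by clear - xE l1; lia.
  rewrite (inner x); [|by clear - x2 l1; lia..].
  by rewrite eq_sym -addbA -oddD -x2 /= negbK.
rewrite !inner //; [|by clear - sx; lia|by clear - ys; lia].
by rewrite /= addbN; case: (_ (+) _).
Qed.

Lemma theta_colorable2 r p q : 0 < r -> 0 < p -> 0 < q ->
  odd r = odd p -> odd r = odd q -> colorable (theta r p q) 2.
Proof.
move=> r0 p0 q0 rp rq.
(* Label 0 is coloured [false] and label 1 by the common parity of the lengths. On each arm the
   parity is shifted so that the first internal vertex is coloured [true]. *)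
pose c i := if i < 2 then (i == 1) && odd r else if i <= r then ~~ odd i else
  if i < r + p then odd r (+) odd i else ~~ odd (r + p) (+) odd i.
have cA i : 1 < i -> i <= r -> c i = true (+) odd i.
  by move=> i2 ir; rewrite /c ltnNge i2 /= ir.
have cB i : r < i -> i < r + p -> c i = odd r (+) odd i.
  by move=> ri ip; rewrite /c ltnNge (leq_ltn_trans r0 ri) /= leqNgt ri /= ip.
have cC i : r + p <= i -> c i = ~~ odd (r + p) (+) odd i.
  move=> ip; have i2 : 1 < i by clear - ip r0 p0; lia.
  have ri : r < i by clear - ip p0; lia.
  by rewrite /c ltnNge i2 /= leqNgt ri /= ltnNge ip.
have cE x y : theta_edge r p q x y -> c x != c y.
  case/or3P => h; [apply: (@arm_alternates c true 2 r x y r0 _ _ _ h)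
    |apply: (@arm_alternates c (odd r) r.+1 p x y p0 _ _ _ h)
    |apply: (@arm_alternates c (~~ odd (r + p)) (r + p) q x y q0 _ _ _ h)].
  - by move=> i i2 ir; apply: cA => //; clear - i2 ir; lia.
  - by move=> r1; rewrite /c r1.
  - by rewrite /c /=; case: odd.
  - by move=> i i2 ir; apply: cB => //; clear - i2 ir; lia.
  - by move=> p1; rewrite /c rp p1.
  - by rewrite /c /= -rp; case: odd.
  - by move=> i i2 ir; apply: cC.
  - by move=> q1; rewrite /c rq q1.
  - by rewrite /c /= -rq; case: odd; case: odd.
exists (fun i : 'I_(_) => inord (c i)) => x y; rewrite thetaE // => /andP[_ h].
have {h} : c x != c y by case/orP: h => /cE //; rewrite eq_sym.
apply: contra => /eqP /(congr1 (@nat_of_ord _)) /=; rewrite !inordK //; try by case: (c _).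
by case: (c x); case: (c y).
Qed.

Definition arm_vertex (s l j : nat) : nat :=
  if j == 0 then 0 else if j < l then s + j - 1 else 1.

Lemma arm_vertex_edge s l j : j < l -> arm_edge s l (arm_vertex s l j) (arm_vertex s l j.+1).
Proof.
move=> jl; rewrite /arm_vertex /arm_edge /=.
by do ?case: ifP; lia.
Qed.

(** Walking along an arm flips the colour at every step, so the colours at the two ends determine
    the parity of the length of every arm. *)
Lemma theta_colorable2_parity r p q : 0 < r -> 0 < p -> 0 < q -> 1 < r + p + q - 1 ->
  colorable (theta r p q) 2 -> odd r = odd p /\ odd r = odd q.
Proof.
move=> r0 p0 q0 n1 [c cP].
have [b b_edge] : exists b : nat -> bool, forall x y, theta_edge r p q x y -> b y = ~~ b x.
  pose b i := odd (nth ord0 [seq c x | x <- enum 'I_(r + p + q - 1)] i).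
  have bE (i : 'I_(r + p + q - 1)) : b i = odd (c i).
    by rewrite /b (nth_map i) ?size_enum_ord // nth_ord_enum.
  exists b => x y /(theta_edge_theta r0 p0 q0 n1)[i [j [<- <- /cP]]]; rewrite !bE.
  by case: (c i) (c j) => [[|[|?]] ?] [[|[|?]] ?].
have arm s l : 0 < l -> (forall x y, arm_edge s l x y -> theta_edge r p q x y) ->
    b 1 = b 0 (+) odd l.
  move=> l0 sub; suff H j : j <= l -> b (arm_vertex s l j) = b 0 (+) odd j.
    rewrite -H // /arm_vertex ltnn; by case: eqP l0 => // ->.
  elim: j => [|j IH] jl; first by rewrite /arm_vertex addbF.
  by rewrite (b_edge _ _ (sub _ _ (arm_vertex_edge s jl))) (IH (ltnW jl)) /= addbN.
have h1 := arm 2 r r0 _; have h2 := arm r.+1 p p0 _; have h3 := arm (r + p) q q0 _.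
move: h1 h2 h3; rewrite /theta_edge => h1 h2 h3.
have {}h1 := h1 (fun x y h => introT or3P (Or31 _ _ h)).
have {}h2 := h2 (fun x y h => introT or3P (Or32 _ _ h)).
have {}h3 := h3 (fun x y h => introT or3P (Or33 _ _ h)).
by split; [move: h1; rewrite h2 | move: h1; rewrite h3]; case: (b 0); do 2!case: odd.
Qed.

(** * Labellings of theta graphs for bicliques and near-bicliques *)

Lemma half_witness i : exists a, i./2 = a /\ i = a + a + odd i.
Proof. by exists i./2; rewrite addnn addnC odd_double_half. Qed.

(* The labels sent to the small side are chosen so that halving is injective on
   them; label 1, when it is among them, takes the value [r./2] left free at the
   junction of the first two arms. *)
Lemma biclique_labelling r p q k (n := r + p + q - 1) : 0 < r -> 0 < p -> 0 < q ->
    odd r = odd p -> odd r = odd q ->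
    r + p + q = (if odd r then 2 * k + 3 else 2 * k + 4) ->
  exists (isA : pred nat) (rk : nat -> nat), [/\ forall i, i < n -> isA i -> rk i <= k,
    forall i j, i < n -> j < n -> isA i -> isA j -> rk i = rk j -> i = j
    & forall x y, theta_edge r p q x y -> isA x != isA y].
Proof.
move=> r0 p0 q0 rp rq; rewrite -/n.
have [R [_ rE]] := half_witness r; have [P [_ pE]] := half_witness p.
have [Q [_ qE]] := half_witness q.
have nE : n = r + p + q - 1 by []; clearbody n.
case odr: (odd r) => sz; rewrite odr in rE rp rq; rewrite -rp in pE; rewrite -rq in qE.
  (* Odd lengths: the ends lie on opposite sides. Here [n = 2 * k + 2], so the odd labels from 3 on
     have halves between 1 and [k], and 0 takes the remaining rank. *)
  pose isA i := if i < 2 then i == 0 else odd i.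
  have spec i : isA i -> i = 0 /\ i./2 = 0 \/ exists a, [/\ i./2 = a, i = a + a + 1 & 0 < a].
    rewrite /isA; case: ltnP => [_ /eqP->|i2 oi]; first by left.
    right; have [a [aE iE]] := half_witness i; rewrite oi in iE; exists a; split=> //.
    by clear - i2 iE; lia.
  exists isA, half; split.
  - move=> i hi /spec[[_ ->] //|[a [-> iE _]]]; clear - hi iE nE sz; lia.
  - move=> i j _ _ /spec[[-> ->]|[a [-> -> a0]]] /spec[[-> ->]|[a' [-> -> a0']]] //.
    + by move=> h; rewrite -h in a0'.
    + by move=> h; rewrite h in a0.
    + by move=> ->.
  move=> x y /or3P[] h; [apply: (@arm_alternates isA false _ _ _ _ r0 _ _ _ h)
    |apply: (@arm_alternates isA false _ _ _ _ p0 _ _ _ h)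
    |apply: (@arm_alternates isA false _ _ _ _ q0 _ _ _ h)] => //.
  - by move=> i i2 _; rewrite /isA ltnNge i2.
  - by rewrite /= odr.
  - by move=> i ri _; rewrite /isA ltnNge (leq_trans _ ri) //; clear - r0; lia.
  - by rewrite /= odr -rp.
  - by move=> i ri _; rewrite /isA ltnNge (leq_trans _ ri) //; clear - r0 p0; lia.
  - by rewrite oddD odr -rp -rq.
(* Even lengths: both ends lie in [isA]. The second arm starts at the odd label [r + 1], a neighbour
   of 0, so the parity test is reversed there. *)
pose isA i := if i < 2 then true else if r < i < r + p then ~~ odd i else odd i.
pose rk i := if i == 1 then R else i./2.
have spec i : isA i -> [\/ i = 0 /\ rk i = 0, i = 1 /\ rk i = R |
    exists a, rk i = a /\ [\/ i = a + a + 1 /\ 0 < a /\ i < r,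
      i = a + a /\ r < i < r + p | i = a + a + 1 /\ r + p <= i]].
  rewrite /isA /rk; case: ltnP => [|i2].
    by case: i => [|[|i]] // _ _; [constructor 1|constructor 2].
  have i1 : i != 1 by clear - i2; lia.
  rewrite (negPf i1); have [a [aE iE]] := half_witness i.
  case: ifP => rip oi; constructor 3; exists a; split=> //.
    by constructor 2; rewrite (negPf oi) addn0 in iE.
  rewrite oi in iE; have [ip|ip] := ltnP i (r + p); last by constructor 3.
  constructor 1; split=> //; split; first by clear - iE i2; lia.
  have ri : i <= r by move: rip; rewrite ip andbT => /negbT; rewrite -leqNgt.
  by clear - ri iE rE; lia.
exists isA, rk; split.
- move=> i hi /spec[[_ ->]//|[_ ->]|[a [-> [[iE _]|[iE ib]|[iE _]]]]].
  + by clear - sz rE pE qE p0 q0; lia.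
  + by clear - hi nE iE sz; lia.
  + by clear - ib qE q0 iE sz; lia.
  + by clear - hi nE iE sz; lia.
- move=> i j hi hj /spec[[-> ->]|[-> ->]|[a [-> di]]] /spec[[-> ->]|[-> ->]|[a' [-> dj]]] //.
  + by clear - rE r0; lia.
  + by case: dj => [[iE [i0 _]]|[iE i0]|[iE i0]] h; clear - iE i0 h r0 p0; lia.
  + by clear - rE r0; lia.
  + by case: dj => [[iE [i0 i1]]|[iE i0]|[iE i0]] h; [clear - iE i1 h rE|clear - iE i0 h rE
      |clear - iE i0 h rE p0 pE]; lia.
  + by case: di => [[iE [i0 _]]|[iE i0]|[iE i0]] h; clear - iE i0 h r0 p0; lia.
  + by case: di => [[iE [i0 i1]]|[iE i0]|[iE i0]] h; [clear - iE i1 h rE|clear - iE i0 h rE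
      |clear - iE i0 h rE p0 pE]; lia.
  + move=> h; rewrite -{}h in dj.
    case: di => [[iE [i0 i1]]|[iE i0]|[iE i0]]; case: dj => [[jE [j0 j1]]|[jE j0]|[jE j0]].
    * by rewrite iE.
    * by clear - iE jE i1 j0; lia.
    * by clear - iE jE i1 j0; lia.
    * by clear - iE jE i0 j1; lia.
    * by rewrite iE.
    * by clear - iE jE i0 j0 rE pE; lia.
    * by clear - iE jE i0 j1; lia.
    * by clear - iE jE i0 j0 rE pE; lia.
    * by rewrite iE.
move=> x y /or3P[] h; [apply: (@arm_alternates isA false _ _ _ _ r0 _ _ _ h)
  |apply: (@arm_alternates isA true _ _ _ _ p0 _ _ _ h)
  |apply: (@arm_alternates isA false _ _ _ _ q0 _ _ _ h)] => //.
- move=> i i2 ir; have -> : isA i = odd i; last by [].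
  by rewrite /isA ltnNge i2 /= ltnNge (_ : i <= r) //; clear - i2 ir; lia.
- by move=> r1; rewrite r1 in odr.
- by rewrite odr.
- move=> i ri ip; rewrite /isA ltnNge (leq_ltn_trans r0 ri) /= ri (_ : i < r + p) //.
  by clear - ri ip; lia.
- by move=> p1; rewrite p1 in rp.
- by rewrite /= odr -rp.
- move=> i ip _; rewrite /isA ltnNge (_ : 1 < i) /=; last by clear - ip r0 p0; lia.
  by rewrite andbC ltnNge ip.
- by move=> q1; rewrite q1 in rq.
- by rewrite oddD odr -rp -rq.
Qed.

Section Embeddings.
Variables (T : finType) (e : rel T).
Hypotheses (sym_e : symmetric e) (irr_e : irreflexive e).

Lemma theta_in_biclique_labels r p q k (a y : nat -> T) :
    0 < r -> 0 < p -> 0 < q ->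
    odd r = odd p -> odd r = odd q -> r + p + q = (if odd r then 2 * k + 3 else 2 * k + 4) ->
    {in gtn k.+1 &, injective a} -> {in gtn (r + p + q - 1) &, injective y} ->
    (forall i j, i <= k -> j < r + p + q - 1 -> e (a i) (y j)) ->
  contains_theta e r p q.
Proof.
move=> r0 p0 q0 rp rq sz ainj yinj ay.
have [isA [rk [rk_le rk_inj isA_edge]]] := biclique_labelling r0 p0 q0 rp rq sz.
have n1 : 1 < r + p + q - 1 by move: sz; case: ifP; lia.
pose f i := if isA i then a (rk i) else y i.
have ne i j : i <= k -> j < r + p + q - 1 -> a i != y j.
  by move=> ik jn; apply: contraTneq (ay _ _ ik jn) => ->; rewrite irr_e.
exists f; split=> [i j|i j h].
  rewrite !inE /f => hi hj; case Ai: (isA i); case Aj: (isA j).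
  - by move/ainj; rewrite !inE !ltnS !rk_le // => /(_ isT isT); exact: rk_inj.
  - by move/eqP; rewrite (negPf (ne _ _ _ _)) ?rk_le.
  - by move/eqP; rewrite eq_sym (negPf (ne _ _ _ _)) ?rk_le.
  - by apply: yinj; rewrite !inE.
have [hi hj _] := theta_edge_lt r0 p0 q0 n1 h.
have := isA_edge _ _ h; rewrite /f.
case Ai: (isA i); case Aj: (isA j) => // _; first by rewrite ay ?rk_le.
by rewrite sym_e ay ?rk_le.
Qed.
End Embeddings.

(* The labels in [isA] are sent to [k + 1] hubs according to their rank [rk], the
   others to common neighbours of the hubs.  The label [l0] is exceptional: it
   may be sent to any vertex adjacent to the image of 0 and to the images of
   [l1] and [l2]. *)
Definition near_biclique_labelling (r p q k : nat) (isA : pred nat) (rk : nat -> nat)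
    (l0 l1 l2 : nat) : Prop :=
  let n := r + p + q - 1 in
  [/\ forall i, i < n -> isA i -> rk i <= k,
      forall i j, i < n -> j < n -> isA i -> isA j -> rk i = rk j -> i = j,
      [/\ l0 < n, l1 < n, l2 < n & l1 != l2] /\ [/\ isA 0, isA l0, ~~ isA l1, ~~ isA l2 & l0 != 0],
      rk 0 = 0
    & forall x y, theta_edge r p q x y ->
        [|| [&& x != l0, y != l0 & isA x != isA y], (x == 0) && (y == l0),
            (x == l0) && ((y == l1) || (y == l2)) | (y == l0) && ((x == l1) || (x == l2))]].

Lemma arm_edge_bounds s l x y : 0 < l -> 1 < s -> arm_edge s l x y ->
  [/\ x < s + l - 1, y < s + l - 1 & x != 1].
Proof.
by move=> l0 s1 /or4P[] /and3P[h1 h2 h3]; split; clear - l0 s1 h1 h2 h3; lia.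
Qed.

Lemma arm_edge_one s l x : 1 < s -> arm_edge s l x 1 -> (l == 1) && (x == 0) \/ x = s + l - 2.
Proof.
move=> s1 /or4P[] /and3P[h1 h2 h3]; [left; by rewrite h1| | |].
- by exfalso; clear - s1 h3; lia.
- by right; apply/eqP.
- by exfalso; clear - s1 h1 h2; lia.
Qed.

(* On the third arm all the edges but the first two are alternating. *)
Lemma last_arm_edge (isA : pred nat) (s l x y : nat) : 1 < s -> 1 < l ->
    (forall i, s <= i -> isA i = ~~ odd i) -> ~~ odd s -> isA 1 = odd l ->
    arm_edge s l x y ->
  [|| [&& x != s, y != s & isA x != isA y], (x == 0) && (y == s)
    | (x == s) && (y == if l == 2 then 1 else s + 1)].
Proof.
move=> s1 l1 inner os one; have s1' : 1 != s by clear - s1; lia.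
case/or4P => /and3P[h1 h2 h3].
- by exfalso; clear - h1 l1; lia.
- by rewrite h2 h3 orbT.
- rewrite (eqP h3) in h2 *; rewrite s1'; have [l2|l2] := eqVneq l 2.
    by rewrite (_ : x = s) ?eqxx ?orbT //; clear - h2 l2; lia.
  have x2 : x.+2 = s + l by clear - h2 l1; lia.
  have xs : x != s by clear - x2 l1 l2; lia.
  rewrite xs one inner; last by clear - x2 l1; lia.
  have : odd x.+2 = odd l by rewrite x2 oddD (negPf os).
  by rewrite /= negbK => ->; case: (odd l).
have [xs|xs] := eqVneq x s.
  rewrite (eqP h2) xs (_ : (l == 2) = false) ?addn1 ?eqxx ?orbT //.
  by clear - xs h2 h3; lia.
rewrite (eqP h2) !inner ?(leq_trans h1) // (_ : x.+1 != s); last by clear - h1; lia.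
by rewrite /=; case: odd.
Qed.

(** The odd arms put 0 and 1 on opposite sides, which conflicts with the even arm. The conflict is
    moved to the first edge of that arm: its first internal vertex [r + p] joins the side of 0. *)
Lemma near_biclique_odd r p q k : 0 < r -> 0 < p -> 0 < q -> 1 < k ->
  odd r -> odd p -> ~~ odd q -> r + p + q = 2 * k + 2 ->
  exists isA rk l0 l1 l2, near_biclique_labelling r p q k isA rk l0 l1 l2.
Proof.
move=> r0 p0 q0 k1 ro po qe sz.
pose isA i := if i < 2 then i == 0 else if i < r + p then odd i else ~~ odd i.
(* [l1] is the vertex following [r + p] on the third arm; [l2] is a placeholder on the other side,
   distinct from [l1]. *)
pose l1 := if q == 2 then 1 else r + p + 1; pose l2 := if q == 2 then 2 else 1.
have [Q [_ qE]] := half_witness q; rewrite (negPf qe) addn0 in qE.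
have rp2 : 1 < r + p by clear - r0 p0; lia.
have q2 : 1 < q by clear - q0 qE; lia.
have orp : ~~ odd (r + p) by rewrite oddD ro po.
have isAl i : 1 < i -> i < r + p -> isA i = odd i.
  by move=> i2 ir; rewrite /isA ltnNge i2 /= ir.
have isAr i : r + p <= i -> isA i = ~~ odd i.
  by move=> ir; rewrite /isA ltnNge (leq_trans rp2 ir) /= ltnNge ir.
have spec i : isA i -> [\/ i = 0 /\ i./2 = 0, exists a, [/\ i./2 = a, i = a + a + 1, 0 < a & i < r + p]
    | exists a, [/\ i./2 = a, i = a + a & r + p <= i]].
  have [i2|i2] := ltnP i 2; first by rewrite /isA i2 => /eqP->; constructor 1.
  have [a [aE iE]] := half_witness i.
  have [ir|ir] := ltnP i (r + p); [rewrite isAl // => oi|rewrite isAr // => oi].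
    by constructor 2; exists a; rewrite oi in iE; split=> //; clear - iE i2; lia.
  by constructor 3; exists a; rewrite (negPf oi) addn0 in iE.
exists isA, half, (r + p), l1, l2; split => //.
- move=> i hi /spec[[_ ->] //|[a [-> iE _ _]]|[a [-> iE _]]]; by clear - hi iE sz; lia.
- move=> i j _ _ /spec[[-> ->]|[a [-> -> a0 ar]]|[a [-> -> ar]]]
    /spec[[-> ->]|[b [-> -> b0 br]]|[b [-> -> br]]] //.
  + by move=> h; clear - h b0; lia.
  + by move=> h; clear - h br rp2; lia.
  + by move=> h; clear - h a0; lia.
  + by move=> ->.
  + by move=> h; clear - h ar br; lia.
  + by move=> h; clear - h ar rp2; lia.
  + by move=> h; clear - h ar br; lia.
  + by move=> ->.
- split; first by rewrite /l1 /l2; case: eqP => q2'; split; clear - q2' r0 p0 k1 sz q2 qE; lia.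
  have A0 : isA 0 by [].
  have Arp : isA (r + p) by rewrite isAr.
  have nA1 : ~~ isA 1 by [].
  split=> //; rewrite /l1 /l2; last by clear - r0; lia.
    case: eqP => // _; rewrite isAr ?leq_addr // addn1 /= negbK; exact: orp.
  case: eqP => // q2'; rewrite isAl //; clear - k1 sz q2'; lia.
have r1 : 1 < r.+1 by rewrite ltnS.
move=> x y; case/or3P => h.
- have [xb yb _] := arm_edge_bounds r0 (isT : 1 < 2) h.
  have xr : x != r + p by clear - xb p0; lia.
  have yr : y != r + p by clear - yb p0; lia.
  rewrite xr yr /=.
  apply/orP; left; apply: (@arm_alternates isA false _ _ _ _ r0 _ _ _ h) => //.
    by move=> i i2 ir; apply: isAl => //; clear - ir p0; lia.
  by rewrite ro.
- have [xb yb _] := arm_edge_bounds p0 r1 h.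
  have xr : x != r + p by clear - xb; lia.
  have yr : y != r + p by clear - yb; lia.
  rewrite xr yr /=.
  apply/orP; left; apply: (@arm_alternates isA false _ _ _ _ p0 _ _ _ h) => //.
    by move=> i i2 ir; apply: isAl; [clear - i2 r0; lia|clear - ir; lia].
  by rewrite /= ro po.
have := @last_arm_edge isA _ _ _ _ rp2 q2 isAr orp (esym (negPf qe)) h.
by rewrite /l1; case/or3P => [->|->|/andP[-> ->]]; rewrite ?orbT.
Qed.

(** The even arms put 0 and 1 on the same side. If [q = 1] the conflict is the edge between them, so
    1 is exceptional and its other neighbours are the last internal vertices of the first two arms.
    Otherwise the first edge of the third arm carries the conflict, and [l2] is a placeholder. *)
Lemma near_biclique_even r p q k : 0 < r -> 0 < p -> 0 < q -> 1 < k ->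
  ~~ odd r -> ~~ odd p -> odd q -> r + p + q = 2 * k + 3 ->
  exists isA rk l0 l1 l2, near_biclique_labelling r p q k isA rk l0 l1 l2.
Proof.
move=> r0 p0 q0 k1 re pe qo sz.
pose isA i := if i < 2 then true else if i <= r then odd i else ~~ odd i.
pose rk i := if i == 1 then r./2 else i./2.
pose l0 := if q == 1 then 1 else r + p.
pose l1 := if q == 1 then r else r + p + 1; pose l2 := if q == 1 then r + p - 1 else 2.
have [R [RE rE]] := half_witness r; rewrite (negPf re) addn0 in rE.
have [P [_ pE]] := half_witness p; rewrite (negPf pe) addn0 in pE.
have [Q [_ qE]] := half_witness q; rewrite qo in qE.
have r2 : 1 < r by clear - r0 rE; lia.
have p2 : 1 < p by clear - p0 pE; lia.
have rp2 : 1 < r + p by clear - r0 p0; lia.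
have orp : ~~ odd (r + p) by rewrite oddD (negPf re) (negPf pe).
have isAl i : 1 < i -> i <= r -> isA i = odd i.
  by move=> i2 ir; rewrite /isA ltnNge i2 /= ir.
have isAr i : r < i -> isA i = ~~ odd i.
  by move=> ir; rewrite /isA ltnNge (leq_ltn_trans r0 ir) /= leqNgt ir.
have spec i : isA i -> [\/ i = 0 /\ rk i = 0, i = 1 /\ rk i = R |
    exists a, rk i = a /\ (i = a + a + 1 /\ 0 < a /\ i < r \/ i = a + a /\ r < i)].
  have [i2|i2] := ltnP i 2.
    by move: i2; case: i => [|[|i]] // _ _; [constructor 1|constructor 2].
  have [a [aE iE]] := half_witness i; rewrite /rk (_ : (i == 1) = false); last by clear - i2; lia.
  have [ir|ir] := leqP i r; [rewrite isAl // => oi|rewrite isAr // => oi]; constructor 3; exists a; split=> //.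
    by left; rewrite oi in iE; split=> //; clear - iE i2 rE ir; lia.
  by right; rewrite (negPf oi) addn0 in iE.
exists isA, rk, l0, l1, l2; split => //.
- move=> i hi /spec[[_ ->] //|[_ ->]|[a [-> [[iE _]|[iE _]]]]].
  + by clear - rE pE p0 sz; lia.
  + by clear - hi iE sz; lia.
  + by clear - hi iE sz; lia.
- move=> i j _ _ /spec[[-> ->]|[-> ->]|[a [-> di]]] /spec[[-> ->]|[-> ->]|[b [-> dj]]] //.
  + by clear - rE r0; lia.
  + by case: dj => [[jE [j0 _]]|[jE j0]] h; clear - jE j0 h r0; lia.
  + by clear - rE r0; lia.
  + by case: dj => [[jE [_ j1]]|[jE j1]] h; clear - jE j1 h rE; lia.
  + by case: di => [[iE [i0 _]]|[iE i0]] h; clear - iE i0 h r0; lia.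
  + by case: di => [[iE [_ i1]]|[iE i1]] h; clear - iE i1 h rE; lia.
  + move=> h; rewrite -{}h in dj; case: di dj => [[iE [_ i1]]|[iE i1]] [[jE [_ j1]]|[jE j1]].
    * by rewrite iE.
    * by clear - iE jE i1 j1; lia.
    * by clear - iE jE i1 j1; lia.
    * by rewrite iE.
- rewrite /l0 /l1 /l2; case: eqP => q1; (split; first by split; clear - q1 r2 p2 q0 sz qE; lia).
    split=> //; first by rewrite isAl.
    rewrite isAr; last by clear - p2; lia.
    have : odd (r + p - 1).+1 = odd (r + p) by congr odd; clear - rp2; lia.
    by rewrite (negPf orp) /= => /negbFE ->.
  split=> //.
  + by rewrite isAr //; clear - p0; lia.
  + rewrite isAr; last by clear - p0; lia.
    by rewrite addn1 /= negbK.
  + by rewrite isAl.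
  + by clear - r0; lia.
have s2 : 1 < r.+1 by rewrite ltnS.
have alt12 x y : arm_edge 2 r x y || arm_edge r.+1 p x y -> isA x != isA y.
  case/orP => h; [apply: (@arm_alternates isA false _ _ _ _ r0 _ _ _ h)
    |apply: (@arm_alternates isA true _ _ _ _ p0 _ _ _ h)].
  - by move=> i i2 ir; apply: isAl => //; clear - ir; lia.
  - by move=> r1; rewrite r1 in r2.
  - by rewrite (negPf re).
  - by move=> i i2 ir; apply: isAr.
  - by move=> p1; rewrite p1 in p2.
  - by rewrite /= (negPf re) (negPf pe).
move=> x y h; rewrite /l0 /l1 /l2; have [q1|q1] := eqVneq q 1.
  have [y1|y1] := eqVneq y 1.
    rewrite y1 in h; case/or3P: h => h.
    - case: (arm_edge_one (isT : 1 < 2) h) => [/andP[/eqP r1]|->]; first by rewrite r1 in r2.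
      by rewrite add2n subn2 eqxx !orbT.
    - case: (arm_edge_one s2 h) => [/andP[/eqP p1]|->]; first by rewrite p1 in p2.
      by rewrite (_ : r.+1 + p - 2 = r + p - 1) ?eqxx ?orbT //; clear; lia.
    case: (arm_edge_one rp2 h) => [/andP[_ ->]|->]; first by rewrite !orbT.
    by rewrite q1 (_ : r + p + 1 - 2 = r + p - 1) ?eqxx ?orbT //; clear; lia.
  have h12 : arm_edge 2 r x y || arm_edge r.+1 p x y.
    case/or3P: h => [->|->|]; rewrite ?orbT //.
    rewrite q1 => /or4P[] /and3P[h1 h2 h3]; exfalso; first by rewrite h3 in y1.
    - by clear - h1; lia.
    - by clear - h1; lia.
    - by clear - h1 h2 h3; lia.
  have x1 : x != 1.
    by case/orP: h12 => h12; [case: (arm_edge_bounds r0 (isT : 1 < 2) h12)|case: (arm_edge_bounds p0 s2 h12)].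
  by rewrite x1 (alt12 _ _ h12).
have q2 : 1 < q by clear - q1 q0; lia.
case/or3P: h => h.
- have [xb yb _] := arm_edge_bounds r0 (isT : 1 < 2) h.
  have xr : x != r + p by clear - xb p0; lia.
  have yr : y != r + p by clear - yb p0; lia.
  rewrite xr yr /=.
  by rewrite alt12 ?h.
- have [xb yb _] := arm_edge_bounds p0 s2 h.
  have xr : x != r + p by clear - xb; lia.
  have yr : y != r + p by clear - yb; lia.
  rewrite xr yr /=.
  by rewrite alt12 ?h ?orbT.
have inner i : r + p <= i -> isA i = ~~ odd i by move=> ir; apply: isAr; clear - ir p0; lia.
have := @last_arm_edge isA _ _ _ _ rp2 q2 inner orp (esym qo) h.
have -> : (q == 2) = false by apply/negP => /eqP q2'; rewrite q2' in qo.
by case/or3P => [->|->|/andP[-> ->]]; rewrite ?orbT.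
Qed.

(** * Theta graphs inside dense configurations *)

Section SetEmbeddings.
Variables (T : finType) (e : rel T).
Hypotheses (sym_e : symmetric e) (irr_e : irreflexive e).

Lemma nth_enum_inj (D : {set T}) x0 i j : i < #|D| -> j < #|D| ->
  nth x0 (enum D) i = nth x0 (enum D) j -> i = j.
Proof. by rewrite !cardE => hi hj /eqP; rewrite nth_uniq ?enum_uniq // => /eqP. Qed.

Lemma nth_enum_mem (D : {set T}) x0 i : i < #|D| -> nth x0 (enum D) i \in D.
Proof. by rewrite cardE => hi; rewrite -mem_enum mem_nth. Qed.

Lemma biclique_contains_theta r p q k (A Y : {set T}) :
    0 < r -> 0 < p -> 0 < q ->
    odd r = odd p -> odd r = odd q -> r + p + q = (if odd r then 2 * k + 3 else 2 * k + 4) ->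
    k < #|A| -> r + p + q - 1 <= #|Y| -> {in A & Y, forall a y, e a y} ->
  contains_theta e r p q.
Proof.
move=> r0 p0 q0 rp rq sz kA nY AY.
have /card_gt0P[a0 _] : 0 < #|A| by lia.
apply: (@theta_in_biclique_labels T e sym_e irr_e _ _ _ k
          (nth a0 (enum A)) (nth a0 (enum Y))) => // [i j|i j|i j ik jn].
- by rewrite !inE => hi hj; apply: nth_enum_inj; lia.
- by rewrite !inE => hi hj; apply: nth_enum_inj; lia.
by apply: AY; apply: nth_enum_mem; lia.
Qed.

Lemma enum_apex (A : {set T}) u a k j0 : u \in A -> k < #|A| -> a != u -> 0 < j0 <= k ->
  exists al : nat -> T, [/\ al 0 = u, al j0 = a, forall i, i <= k -> i != j0 -> al i \in A
    & forall i j, i <= k -> j <= k -> al i = al j -> i = j].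
Proof.
move=> uA kA au j0k; pose s := u :: a :: enum (A :\ u :\ a).
have us : uniq s by rewrite /= !inE !mem_enum !inE eq_sym (negPf au) !eqxx enum_uniq ?andbF.
have ss : k < size s.
  rewrite /= -cardE; have := cardsD1 u A; have := cardsD1 a (A :\ u); rewrite uA.
  by case: (a \in _) => /=; lia.
pose sg i := if i == 0 then 0 else if i == j0 then 1 else if i < j0 then i.+1 else i.
have sg_le i : i <= k -> sg i < size s.
  by clear - j0k ss; rewrite /sg; do ?case: ifP; lia.
have sg_inj i j : sg i = sg j -> i = j.
  by clear - j0k; rewrite /sg; do ?case: ifP; lia.
have sg1 i : i != j0 -> sg i != 1.
  by clear - j0k; rewrite /sg; do ?case: ifP; lia.
exists (fun i => nth u s (sg i)); split=> [//||i ik ij|i j ik jk /eqP].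
- by rewrite /sg eqxx; case: eqP j0k => // ->.
- have := sg1 _ ij; have := sg_le _ ik; case: (sg i) => [|[|l]] //= ls _.
  suff : nth u (enum (A :\ u :\ a)) l \in A :\ u :\ a by rewrite !inE => /and3P[].
  by apply: nth_enum_mem; rewrite cardE.
by rewrite nth_uniq ?sg_le // => /eqP/sg_inj.
Qed.

(** The margin of 3 in the size of [Y] leaves [n] vertices once [v], [v'] and [a] are set aside. *)
Lemma enum_marked (Y : {set T}) v v' a n l1 l2 : v \in Y -> v' \in Y -> v != v' ->
  a != v -> a != v' -> l1 != l2 -> n + 3 <= #|Y| ->
  exists y : nat -> T, [/\ y l1 = v, y l2 = v', forall i, i < n -> (y i \in Y) && (y i != a)
    & forall i j, i < n -> j < n -> y i = y j -> i = j].
Proof.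
move=> vY v'Y vv' av av' l12 nY; pose s := v :: v' :: enum (Y :\: [set v; v'; a]).
have us : uniq s by rewrite /= !inE !mem_enum !inE (negPf vv') !eqxx ?orbT enum_uniq.
have ss : n.+1 < size s.
  rewrite /= -cardE cardsD; have := subset_leq_card (subsetIr Y [set v; v'; a]).
  have : #|[set v; v'; a]| <= 3.
    by rewrite (leq_trans (leq_card_setU _ _)) // cards1 cards2; case: (_ != _).
  by lia.
pose sg i := if i == l1 then 0 else if i == l2 then 1 else i.+2.
have sg_le i : i < n -> sg i < size s.
  by clear - ss; rewrite /sg; do ?case: ifP; lia.
have sg_inj i j : sg i = sg j -> i = j.
  by clear - l12; rewrite /sg; do ?case: ifP; lia.
exists (fun i => nth v s (sg i)); split=> [||i hi|i j hi hj /eqP].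
- by rewrite /sg eqxx.
- by rewrite /sg eqxx eq_sym (negPf l12).
- have := sg_le _ hi; case: (sg i) => [|[|l]] /= ls.
    by rewrite vY eq_sym.
    by rewrite v'Y eq_sym.
  have : nth v (enum (Y :\: [set v; v'; a])) l \in Y :\: [set v; v'; a].
    by apply: nth_enum_mem; rewrite cardE; lia.
  by rewrite !inE => /andP[/norP[_ ->] ->].
by rewrite nth_uniq ?sg_le // => /eqP/sg_inj.
Qed.

(** Label 0 goes to [u], the exceptional label [l0] to [a], and [l1], [l2] to [v], [v']. All the
    other edges of the theta graph run between [A] and [Y]. *)
Lemma near_biclique_contains_theta r p q k isA rk l0 l1 l2 (A Y : {set T}) u a v v' :
    0 < r -> 0 < p -> 0 < q -> 1 < r + p + q - 1 ->
    near_biclique_labelling r p q k isA rk l0 l1 l2 ->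
    k < #|A| -> r + p + q + 2 <= #|Y| -> {in A & Y, forall b y, e b y} ->
    u \in A -> e u a -> v \in Y -> v' \in Y -> v != v' -> e a v -> e a v' ->
  contains_theta e r p q.
Proof.
move=> r0 p0 q0 n1 [rk_le rk_inj [[l0n l1n l2n l12] [A0 Al0 Al1 Al2 l00]] rk0 edges].
set n := r + p + q - 1 in rk_le rk_inj l0n l1n l2n.
move=> kA nY AY uA ua vY v'Y vv' av av'.
have neq_e x y : e x y -> x != y by apply: contraTneq => ->; rewrite irr_e.
pose j0 := rk l0.
have j0k : j0 <= k by exact: rk_le.
have j00 : 0 < j0.
  rewrite lt0n; apply: contraNneq l00 => h; apply/eqP/rk_inj => //; last by rewrite rk0.
  exact: leq_ltn_trans (leq0n _) l0n.
have au : a != u by rewrite eq_sym neq_e.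
have [|al [al0 alj0 alA al_inj]] := @enum_apex A u a k j0 uA kA au; first by rewrite j00.
have [|y [y1 y2 yYa y_inj]] :=
    @enum_marked Y v v' a n l1 l2 vY v'Y vv' (neq_e _ _ av) (neq_e _ _ av') l12.
  by rewrite /n; clear - nY r0; lia.
have yY i : i < n -> y i \in Y by case/yYa/andP.
have ya i : i < n -> y i != a by case/yYa/andP.
have aly i j : i <= k -> j < n -> al i != y j.
  move=> ik jn; have [->|ij] := eqVneq i j0; first by rewrite alj0 eq_sym ya.
  by apply: neq_e; apply: AY; [apply: alA | apply: yY].
pose f i := if isA i then al (rk i) else y i.
exists f; rewrite -/n; split=> [i j|i j h].
  rewrite !inE /f => hi hj; case Ai: (isA i); case Aj: (isA j).
  - by move/al_inj => h; apply: rk_inj => //; apply: h; apply: rk_le.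
  - by move/eqP; rewrite (negPf (aly _ _ _ _)) ?rk_le.
  - by move/eqP; rewrite eq_sym (negPf (aly _ _ _ _)) ?rk_le.
  - exact: y_inj.
have [hi hj _] := theta_edge_lt r0 p0 q0 n1 h.
case/or4P: (edges _ _ h) => [/and3P[il0 jl0 ne]|/andP[/eqP-> /eqP->]|/andP[/eqP-> jl]|/andP[/eqP-> il]].
- rewrite /f; move: ne; case Ai: (isA i); case Aj: (isA j) => // _.
    apply: AY (yY _ hj); apply: alA; first exact: rk_le.
    by apply: contra il0 => /eqP h'; apply/eqP/rk_inj.
  rewrite sym_e; apply: AY (yY _ hi); apply: alA; first exact: rk_le.
  by apply: contra jl0 => /eqP h'; apply/eqP/rk_inj.
- by rewrite /f A0 Al0 rk0 -/j0 alj0 al0.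
- rewrite /f Al0 -/j0 alj0.
  by case/orP: jl => /eqP->; rewrite ?(negPf Al1) ?(negPf Al2) ?y1 ?y2.
- rewrite /f Al0 -/j0 alj0 sym_e.
  by case/orP: il => /eqP->; rewrite ?(negPf Al1) ?(negPf Al2) ?y1 ?y2.
Qed.

Lemma min_degree_contains_theta r p q (S : {set T}) u :
    0 < r -> 0 < p -> 0 < q -> 1 < r + p + q - 1 ->
    S != set0 -> {in S, forall v, e u v} ->
    {in S, forall v, r + p + q - 1 <= #|[set w in S | e v w]|} ->
  contains_theta e r p q.
Proof.
(* Label 1 is sent to [u]; removing it leaves a spider centred at 0, which is
   embedded greedily along the parent function [par]. *)
move=> r0 p0 q0 n1 /set0Pn[v0 v0S] uS; set n := r + p + q - 1 => minS.
pose par i := if [|| i == 2, i == r.+1 | i == r + p] then 0 else i.-1.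
have par_lt i : 0 < i -> par i < i by rewrite /par; case: ifP; lia.
have greedy j : 0 < j -> j <= n -> exists f : nat -> T,
    [/\ forall i, i < j -> f i \in S, forall i i', i < j -> i' < j -> f i = f i' -> i = i'
      & forall i, 0 < i -> i < j -> e (f (par i)) (f i)].
  elim: j => // -[_ _ _|j IH _ jn].
    by exists (fun=> v0); split=> // [[|i] [|i']|[|i]].
  have [//||f [fS finj fe]] := IH; first by lia.
  set I := [set f (val i) | i : 'I_j.+1].
  have pj : par j.+1 < j.+1 by apply: par_lt.
  (* The image of the parent has at least [n] neighbours in [S], and only [j.+1 < n] vertices have
     been used. *)
  have /subsetPn[w] : ~~ ([set w in S | e (f (par j.+1)) w] \subset I).
    apply/negP => /subset_leq_card; have := minS _ (fS _ pj).
    have : #|I| <= j.+1 by rewrite -[j.+1 in leqRHS]card_ord leq_imset_card.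
    by lia.
  rewrite inE => /andP[wS ew] wI.
  have fw i : i < j.+1 -> f i != w.
    by move=> ij; apply: contraNneq wI => <-; apply/imsetP; exists (Ordinal ij).
  exists (fun i => if i == j.+1 then w else f i); split=> [i|i i'|i].
  - by rewrite ltnS leq_eqVlt; case: eqP => //= _ /fS.
  - rewrite !(ltnS _ j.+1) (leq_eqVlt i) (leq_eqVlt i').
    case: eqP => [->|_] /=; case: eqP => [->|_] //= hi hi'.
    + by move/eqP; rewrite eq_sym (negPf (fw _ hi')).
    + by move/eqP; rewrite (negPf (fw _ hi)).
    + exact: finj.
  move=> i0; rewrite ltnS leq_eqVlt; case: eqP => [->|ne] /= ij.
    by case: eqP pj => // -> ; rewrite ltnn.
  by case: eqP (par_lt _ i0) => [h|_ _]; [lia | apply: fe].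
have [||f [fS finj fe]] := greedy n; [lia|by []|].
have uf i : i < n -> f i != u.
  by move=> /fS/uS; apply: contraTneq => ->; rewrite irr_e.
exists (fun i => if i == 1 then u else f i); rewrite -/n; split=> [i j|x y h].
  rewrite !inE => hi hj; case: eqP => [->|_]; case: eqP => [->|_] //.
  + by move/eqP; rewrite eq_sym (negPf (uf _ hj)).
  + by move/eqP; rewrite (negPf (uf _ hi)).
  + exact: finj.
have [hx hy _] := theta_edge_lt r0 p0 q0 n1 h.
have feu i : i < n -> e (f i) u by move=> /fS/uS; rewrite sym_e.
have : [|| (x != 1) && (y == 1) | [&& 0 < y, x != 1, y != 1 & par y == x]].
  by rewrite /par; case/or3P: h => /or4P[]/and3P[h1 h2 h3]; case: ifP; lia.
case/orP => [/andP[x1 /eqP->]|/and4P[y0 x1 y1 /eqP ex]].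
  by rewrite (negPf x1) eqxx feu.
by rewrite (negPf x1) (negPf y1) -ex; apply: fe.
Qed.

End SetEmbeddings.

(** * Sparsity of theta-free graphs *)

Definition degenerate_links (T : finType) (e : rel T) (h : nat) : Prop :=
  forall (u : T) (S : {set T}), S != set0 -> {in S, forall v, e u v} ->
  exists2 v, v \in S & #|[set w in S | e v w]| < h.

(* For bipartite theta graphs there is no such pair [A], [Y] at all. *)
Definition thin_bicliques (T : finType) (e : rel T) (h k : nat) : Prop :=
  forall (A Y : {set T}) (u : T), k < #|A| -> h <= #|Y| -> {in A & Y, forall a y, e a y} ->
  u \in A -> 1 < k /\ forall a v v', e u a -> v \in Y -> v' \in Y -> e a v -> e a v' -> v = v'.

(** Being 2-colourable amounts to the three lengths having equal parity. The parity of [r + p + q]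
    then selects one of the two sizes allowed for a given [k]. *)
Lemma theta_hyp_parity r p q k : 0 < r -> 0 < p -> 0 < q ->
  (chromatic_number (theta r p q) 3 /\ 2 <= k /\
     (r + p + q - 1 = 2 * k + 1 \/ r + p + q - 1 = 2 * k + 2))
  \/
  (chromatic_number (theta r p q) 2 /\ 1 <= k /\
     (r + p + q - 1 = 2 * k + 2 \/ r + p + q - 1 = 2 * k + 3)) ->
  (0 < k /\ [/\ odd r = odd p, odd r = odd q & r + p + q = (if odd r then 2 * k + 3 else 2 * k + 4)])
  \/ (1 < k /\ (odd r != odd p \/ odd r != odd q) /\
      (r + p + q = (if odd (r + p + q) then 2 * k + 3 else 2 * k + 2))).
Proof.
move=> r0 p0 q0 [[[_ nc] [k2 sz]]|[[col _] [k1 sz]]]; [right|left].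
  split=> //; split; last by case: ifP; lia.
  have [rp|] := eqVneq (odd r) (odd p); last by left.
  have [rq|] := eqVneq (odd r) (odd q); last by right.
  by case: (nc 2 isT); apply: theta_colorable2.
have [|rp rq] := theta_colorable2_parity r0 p0 q0 _ col; first by lia.
by split=> //; split=> //; case: ifP; lia.
Qed.

(** The only use of theta-freeness. The bound [r + p + q + 2] is the number of vertices of the theta
    graph plus the margin of 3 required by [enum_marked]. *)
Lemma theta_free_sparse n (G : rel 'I_n) r p q k :
    0 < r -> 0 < p -> 0 < q -> simple_graph G -> free_of (theta r p q) G ->
  (chromatic_number (theta r p q) 3 /\ 2 <= k /\
     (r + p + q - 1 = 2 * k + 1 \/ r + p + q - 1 = 2 * k + 2))
  \/
  (chromatic_number (theta r p q) 2 /\ 1 <= k /\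
     (r + p + q - 1 = 2 * k + 2 \/ r + p + q - 1 = 2 * k + 3)) ->
  [/\ 0 < k, degenerate_links G (r + p + q + 2) & thin_bicliques G (r + p + q + 2) k].
Proof.
move=> r0 p0 q0 [symG irrG] freeG hyp; have par := theta_hyp_parity r0 p0 q0 hyp.
have k0 : 0 < k by case: par => -[]; lia.
have no : ~ contains_theta G r p q by move=> h; apply: freeG; apply: contains_theta_subgraph.
have n1 : 1 < r + p + q - 1 by move: hyp; clear - k0; lia.
split=> // [u S S0 uS|A Y u kA hY AY uA].
  apply/exists_inP; apply: contra_notT no; rewrite negb_exists_in => /forall_inP h.
  apply: (min_degree_contains_theta symG irrG (S := S) (u := u)) => // v vS.
  by have := h v vS; clear; lia.
case: par => [[_ [rp rq sz]]|[k1 [neq sz]]].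
  exfalso; apply: no; apply: (biclique_contains_theta symG irrG (k := k) (A := A) (Y := Y)) => //.
  by clear - hY; lia.
split=> // a v v' ua vY v'Y av av'; apply/eqP; apply: contra_notT no => vv'.
(* Among three lengths two have the same parity; it suffices to treat the case where these come
   first. *)
have main r' p' q' : 0 < r' -> 0 < p' -> 0 < q' -> r' + p' + q' = r + p + q ->
    odd r' = odd p' -> odd r' != odd q' -> contains_theta G r' p' q'.
  move=> r0' p0' q0' szE rp rq.
  have [isA [rk [l0 [l1 [l2 lab]]]]] : exists isA rk l0 l1 l2,
      near_biclique_labelling r' p' q' k isA rk l0 l1 l2.
    case or': (odd r'); [apply: near_biclique_odd | apply: near_biclique_even] => //;
      by move: sz; clear - or' rp rq szE; case: ifP; lia.
  apply: (near_biclique_contains_theta symG irrG (A := A) (Y := Y)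
            (u := u) (a := a) (v := v) (v' := v') _ _ _ _ lab) => //.
  - by clear - n1 szE; lia.
  - by clear - hY szE; lia.
have [rp|rp] := eqVneq (odd r) (odd p).
  by apply: main => //; case: neq => //; rewrite rp eqxx.
have [rq|rq] := eqVneq (odd r) (odd q).
  by apply: contains_theta_swap23 => //; apply: main => //; clear; lia.
apply: contains_theta_swap12 => //; apply: contains_theta_swap23 => //.
apply: (main p q r) => //; clear - rp rq; lia.
Qed.

(** * Edge counts and sums of squares *)

(* The largest sum of squares of integers between 0 and [k] whose sum is [P]. *)
Definition packed_squares (k P : nat) : nat := k ^ 2 * (P %/ k) + (P %% k) ^ 2.

(** Source of the integrality gap: adding a term [d < k] that makes the total reach a new multiple
    of [k] leaves a surplus of at least 2 over [d ^ 2]. *)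
Lemma packed_squares_add k P d : d < k ->
  packed_squares k P + d ^ 2 + 2 * ((P + d) %/ k) <= packed_squares k (P + d) + 2 * (P %/ k).
Proof.
move=> dk; have k0 : 0 < k by lia.
pose q := P %/ k; pose c := P %% k; have ck : c < k by rewrite ltn_mod.
have PE : P + d = q * k + (c + d) by rewrite {1}(divn_eq P k) addnA.
rewrite /packed_squares PE divnMDl // modnMDl -/q -/c.
have [lt|ge] := ltnP (c + d) k.
  by rewrite divn_small // modn_small //; nia.
have -> : c + d = 1 * k + (c + d - k) by lia.
rewrite divnMDl // modnMDl divn_small ?modn_small; [|lia..].
(* In these terms [k ^ 2 + z ^ 2 - c ^ 2 - d ^ 2] is twice the product of the positive numbers
   [k - c] and [k - d]. *)
have [a [b [z [-> -> ->]]]] : exists a b z, [/\ k = a.+1 + b.+1 + z, c = b.+1 + z & d = a.+1 + z].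
  by exists (k - c).-1, (k - d).-1, (c + d - k); split; lia.
have -> : b.+1 + z + (a.+1 + z) - (a.+1 + b.+1 + z) = z by lia.
rewrite [_ ^ 2 * (q + _)]mulnDr; move: (_ ^ 2 * q) => K; rewrite addn0 muln1; nia.
Qed.

Lemma sum_squares_le_packed (I : Type) (r : seq I) (P : pred I) (d : I -> nat) k :
  (forall i, P i -> d i < k) -> 0 < k ->
  \sum_(i <- r | P i) d i ^ 2 + 2 * ((\sum_(i <- r | P i) d i) %/ k)
    <= packed_squares k (\sum_(i <- r | P i) d i).
Proof.
move=> dk k0; elim: r => [|i r IH].
  by rewrite !big_nil /packed_squares div0n mod0n.
rewrite !big_cons; case: ifP => // /dk di.
have := packed_squares_add (\sum_(j <- r | P j) d j) di.
by rewrite [d i + _]addnC; lia.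
Qed.

Lemma packed_squares_mono k P j : 0 < k -> packed_squares k P + j <= packed_squares k (P + j).
Proof.
move=> k0; elim: j => [|j IH]; first by rewrite !addn0.
suff : packed_squares k (P + j) < packed_squares k (P + j).+1 by rewrite !addnS; lia.
move: (P + j) => Q; pose q := Q %/ k; pose c := Q %% k; have ck : c < k by rewrite ltn_mod.
have QE : Q.+1 = q * k + c.+1 by rewrite {1}(divn_eq Q k) addnS.
rewrite /packed_squares QE divnMDl // modnMDl -/q -/c.
have [lt|ge] := ltnP c.+1 k.
  by rewrite divn_small // modn_small //; nia.
have -> : c.+1 = k by lia.
by rewrite divnn k0 modnn; nia.
Qed.

(** The halving in [nedges] is exact: without loops, the ordered pairs split into those with [v < w]
    and their mirror images. *)
Lemma sum_adj_nedges n (G : rel 'I_n) : simple_graph G ->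
  (\sum_v \sum_w G v w = 2 * nedges G)%N.
Proof.
move=> [symG irrG].
have cE : #|[set pq : 'I_n * 'I_n | G pq.1 pq.2]| = \sum_v \sum_w G v w.
  rewrite pair_bigA -sum1_card [LHS]big_mkcond; apply: eq_bigr => pq _.
  by rewrite inE; case: (G _ _).
suff even : \sum_v \sum_w G v w = 2 * \sum_(v : 'I_n) \sum_(w : 'I_n | v < w) G v w.
  by rewrite /nedges cE even mulKn.
have spl (v : 'I_n) : \sum_w G v w = \sum_(w : 'I_n | v < w) G v w + \sum_(w : 'I_n | w < v) G v w.
  rewrite (bigID (fun w : 'I_n => v < w)) /=; congr addn.
  rewrite [LHS]big_mkcond [RHS]big_mkcond; apply: eq_bigr => w _; rewrite -leqNgt leq_eqVlt.
  by case: eqP => [/val_inj ->|] //=; rewrite irrG ltnn.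
under eq_bigr => v _ do rewrite spl.
rewrite big_split /= mul2n -addnn; congr addn.
rewrite (exchange_big_dep xpredT) //=; apply: eq_bigr => v _; apply: eq_bigr => w _.
by rewrite symG.
Qed.

Lemma split_edges k m : 'C(k, 2) <= m ->
  (2 * m = k * (k - 1) + 2 * (k * split_t k m + split_s k m))%N.
Proof.
move=> Ckm; have := mul_bin_diag k 1; rewrite bin1 -subn1 => ->.
by rewrite /split_t /split_s [k * _]mulnC -divn_eq -mulnDr subnKC.
Qed.

Local Open Scope ring_scope.

(** Numerical core of the rigidity. Here [t'] counts the vertices adjacent to all hubs, [P] and [S2]
    are the sums of the hub degrees of the other outer vertices and of their squares, [g2] counts
    missing pairs of hubs and [j2] adjacent pairs outside the hubs, both ordered. The edge count
    must match that of the split graph. *)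
Lemma rigid_arithmetic (R : realFieldType) (k t s t' P S2 g2 j2 : nat) (lam X Xs dl eps : R) :
    (0 < k)%N -> (s < k)%N -> (2 * (k * t' + P) + j2 = 2 * (k * t + s) + g2)%N ->
    (g2 <= k * k)%N -> (S2 + 2 * (P %/ k) <= packed_squares k P)%N -> (S2 <= (k - 1) * P)%N ->
    k%:R * (1 - dl) <= X -> X <= k%:R -> s%:R * (1 - dl) <= Xs ->
    0 <= dl -> 0 <= eps -> 16 * k%:R ^+ 2 * dl <= 1 -> 16 * k%:R * eps <= 1 ->
    4 * k%:R ^+ 2 * (k%:R + 1) < lam ->
    lam * g2%:R * (1 - dl) ^+ 2 + t%:R * X ^+ 2 + Xs ^+ 2
      <= t'%:R * X ^+ 2 + S2%:R + k%:R * eps * j2%:R ->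
  [/\ g2 = 0, j2 = 0, t' = t, P = s & S2 = (s ^ 2)%N]%N.
Proof.
move=> k0 sk cnt gk S2f S2P Xl Xu Xsl dl0 eps0 dls epss lamL main.
have k1 : 1 <= k%:R :> R by rewrite ler1n.
have kk : k%:R <= k%:R ^+ 2 :> R by rewrite expr2 -[leLHS]mulr1 ler_wpM2l ?ler0n.
have dlk : 16 * k%:R * dl <= 1.
  by apply: le_trans dls; rewrite ler_wpM2r // ler_pM2l ?ltr0n.
have dl16 : 16 * dl <= 1 by apply: le_trans dlk; rewrite ler_wpM2r //; lra.
have eps16 : 16 * eps <= 1 by apply: le_trans epss; rewrite ler_wpM2r //; lra.
have X2l : k%:R ^+ 2 * (1 - 2 * dl) <= X ^+ 2.
  have h0 : 0 <= k%:R * (1 - dl) by apply: mulr_ge0; lra.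
  have : (k%:R * (1 - dl)) ^+ 2 <= X ^+ 2 by rewrite lerXn2r ?nnegrE // (le_trans h0).
  have : 0 <= k%:R ^+ 2 * dl ^+ 2 by rewrite mulr_ge0 ?sqr_ge0.
  by rewrite exprMn; lra.
have X2u : X ^+ 2 <= k%:R ^+ 2.
  have h0 : 0 <= k%:R * (1 - dl) by apply: mulr_ge0; lra.
  by rewrite lerXn2r ?nnegrE ?ler0n //; lra.
have Xs2 : s%:R ^+ 2 * (1 - 2 * dl) <= Xs ^+ 2.
  have h0 : 0 <= s%:R * (1 - dl) by apply: mulr_ge0; rewrite ?ler0n //; lra.
  have : (s%:R * (1 - dl)) ^+ 2 <= Xs ^+ 2 by rewrite lerXn2r ?nnegrE // (le_trans h0).
  have : 0 <= s%:R ^+ 2 * dl ^+ 2 by rewrite mulr_ge0 ?sqr_ge0.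
  by rewrite exprMn; lra.
have cntR : 2 * (k%:R * t'%:R + P%:R) + j2%:R = 2 * (k%:R * t%:R + s%:R) + g2%:R :> R.
  by have := congr1 (fun n => n%:R : R) cnt; rewrite !(natrD, natrM).
have S2R : S2%:R <= (k%:R - 1) * P%:R :> R.
  by move: S2P; rewrite -(ler_nat R) natrM natrB.
have sR : s%:R <= k%:R :> R by rewrite ler_nat ltnW.
have g0 : g2 = 0%N.
  (* A missing edge between hubs would contribute at least [lam / 2] to the left side of [main],
     whereas the edge count limits the compensating terms to a bound depending on [k] only. *)
  apply/eqP; rewrite -leqn0 leqNgt; apply/negP => g2p.
  have g2R : 1 <= g2%:R :> R by rewrite ler1n.
  have gkR : g2%:R <= k%:R ^+ 2 :> R by rewrite expr2 -natrM ler_nat.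
  pose tau : R := t%:R - t'%:R.
  have ktau : k%:R * tau = P%:R + j2%:R / 2 - s%:R - g2%:R / 2 by rewrite /tau; lra.
  (* [X ^+ 2] lies between [k ^+ 2 * (1 - 2 * dl)] and [k ^+ 2]; which end is
     relevant depends on the sign of [tau]. *)
  have [c [c0 c1 tX]] : exists c : R, [/\ 1 - 2 * dl <= c, c <= 1 & c * k%:R * (k%:R * tau) <= tau * X ^+ 2].
    have [tau0|tau0] := leP 0 tau.
      exists (1 - 2 * dl); split; [by lra|by lra|].
      have := ler_wpM2l tau0 X2l; lra.
    exists 1; split; [by lra|by lra|].
    have := ler_wnM2l (ltW tau0) X2u; lra.
  have kP : (k%:R - 1) * P%:R <= c * k%:R * P%:R.
    rewrite ler_wpM2r ?ler0n //.
    have : (1 - 2 * dl) * k%:R <= c * k%:R by rewrite ler_wpM2r ?ler0n.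
    by lra.
  have kj : k%:R * eps * j2%:R <= c * k%:R * (j2%:R / 2).
    have : k%:R * eps * j2%:R <= k%:R * (c / 2) * j2%:R.
      by rewrite ler_wpM2r ?ler0n // ler_wpM2l ?ler0n //; lra.
    by lra.
  have ksg : c * k%:R * (s%:R + g2%:R / 2) <= k%:R * (k%:R + k%:R ^+ 2).
    apply: ler_pM; rewrite ?mulr_ge0 ?addr_ge0 ?divr_ge0 ?ler0n //; try lra.
    by rewrite -[leRHS]mul1r ler_wpM2r ?ler0n.
  have lg : lam * (1 / 2) <= lam * g2%:R * (1 - dl) ^+ 2.
    have lam0 : 0 <= lam.
      by apply: le_trans (ltW lamL); rewrite !mulr_ge0 ?addr_ge0 ?sqr_ge0 ?ler0n.
    rewrite -mulrA ler_wpM2l //.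
    have d2 : 1 / 2 <= (1 - dl) ^+ 2 by have := sqr_ge0 dl; rewrite expr2; lra.
    by rewrite -[leLHS]mul1r ler_pM //; lra.
  have Xs0 : 0 <= Xs ^+ 2 by apply: sqr_ge0.
  move: tX; rewrite ktau => tX.
  have tXE : tau * X ^+ 2 = t%:R * X ^+ 2 - t'%:R * X ^+ 2 by rewrite /tau; ring.
  have : lam <= 2 * (k%:R * (k%:R + k%:R ^+ 2)) by lra.
  have : k%:R * (k%:R + k%:R ^+ 2) = k%:R ^+ 2 * (k%:R + 1) :> R by ring.
  by have : 0 <= k%:R ^+ 2 * (k%:R + 1) :> R by [rewrite mulr_ge0 ?sqr_ge0 //; lra]; lra.
subst g2; rewrite addn0 in cnt; rewrite mulr0 mul0r add0r in main.
have le_t : (t' <= t)%N.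
  rewrite leqNgt; apply/negP => tt'.
  have : (k * t.+1 <= k * t')%N by rewrite leq_mul2l tt' orbT.
  by rewrite mulnS => h; clear - cnt sk h; lia.
pose tau := (t - t')%N; pose j := (k * tau + s - P)%N.
have kt : (k * t = k * t' + k * tau)%N by rewrite -mulnDr subnKC.
have Pj : (P + j = k * tau + s)%N by rewrite /j; clear - cnt kt; lia.
have j2E : (j2 = 2 * j)%N by clearbody j; clear - cnt kt Pj; lia.
have fE : packed_squares k (P + j) = (k ^ 2 * tau + s ^ 2)%N.
  rewrite Pj /packed_squares (mulnC k tau) divnMDl // modnMDl divn_small // modn_small //.
  by rewrite addn0.
have mono := packed_squares_mono P j k0.
have Pq : (tau <= j + P %/ k)%N.
  rewrite -leq_subLR leq_divRL // mulnBl mulnC.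
  have jk : (j <= j * k)%N by rewrite leq_pmulr.
  by clearbody j tau; clear - jk Pj; lia.
(* The deficit [Z = k ^ 2 * tau + s ^ 2 - S2] satisfies [j <= Z] by [Z1] and [2 * tau <= Z + j] by
   [Z2]. Since [main] bounds [Z] by a small multiple of [tau + j + 1], it is below 1, hence 0, and
   then [j] and [tau] vanish. *)
have Z1 : (S2 + j <= k ^ 2 * tau + s ^ 2)%N.
  by rewrite -fE; apply: leq_trans mono; rewrite leq_add2r; apply: leq_trans S2f; apply: leq_addr.
have Z2 : (S2 + 2 * tau <= k ^ 2 * tau + s ^ 2 + j)%N.
  rewrite -fE; move: S2f mono Pq; move: (packed_squares k P) (packed_squares _ _) (P %/ k)%N.
  by clearbody j tau; clear; lia.
have Z1R : S2%:R + j%:R <= k%:R ^+ 2 * tau%:R + s%:R ^+ 2 :> R.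
  by move: Z1; rewrite -(ler_nat R) !(natrD, natrM, natrX).
have Z2R : S2%:R + 2 * tau%:R <= k%:R ^+ 2 * tau%:R + s%:R ^+ 2 + j%:R :> R.
  by move: Z2; rewrite -(ler_nat R) !(natrD, natrM, natrX).
have tauR : t%:R = t'%:R + tau%:R :> R by rewrite -natrD subnKC.
have j2R : j2%:R = 2 * j%:R :> R by rewrite j2E natrM.
have tX : tau%:R * (k%:R ^+ 2 * (1 - 2 * dl)) <= tau%:R * X ^+ 2 by rewrite ler_wpM2l ?ler0n.
have dt : tau%:R * (16 * k%:R ^+ 2 * dl) <= tau%:R * 1 by rewrite ler_wpM2l ?ler0n.
have ds : 16 * s%:R ^+ 2 * dl <= 1.
  by apply: le_trans dls; rewrite ler_wpM2r // ler_pM2l ?ltr0n // lerXn2r ?nnegrE ?ler0n.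
have ej : j%:R * (16 * k%:R * eps) <= j%:R * 1 by rewrite ler_wpM2l ?ler0n.
have tau0R : 0 <= tau%:R :> R by rewrite ler0n.
have j0R : 0 <= j%:R :> R by rewrite ler0n.
rewrite tauR j2R in main.
pose Z := (k ^ 2 * tau + s ^ 2 - S2)%N.
have ZR : Z%:R = k%:R ^+ 2 * tau%:R + s%:R ^+ 2 - S2%:R :> R.
  by rewrite natrB ?(natrD, natrM, natrX) //; clear - Z1; clearbody j tau; lia.
have Zs : Z%:R < 1 :> R by lra.
have Z0 : Z = 0%N by move: Zs; rewrite (ltr_nat _ _ 1) ltnS leqn0 => /eqP.
have [tau0 j0] : tau = 0%N /\ j = 0%N by clear - Z0 Z1 Z2; rewrite /Z in Z0; clearbody j tau; lia.
have [cj ct] : t' = t /\ j2 = 0%N by clear - le_t tau0 j0 j2E; rewrite /tau in tau0; clearbody j; lia.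
by split=> //; move: Z0 Pj; rewrite /Z tau0 j0 muln0; clear - Z1 tau0; clearbody j tau; lia.
Qed.

(** * Spectral radius of a graph *)

Local Open Scope sesquilinear_scope.

Lemma bigmax_norm_spec (s : seq algC) (M := \big[Num.max/0]_(z <- s) `|z|) :
  [/\ 0 <= M, forall z, z \in s -> `|z| <= M
    & s != [::] -> exists2 z, z \in s & `|z| = M].
Proof.
rewrite {}/M; elim: s => [|a s [M0 Mub Mat]]; first by rewrite big_nil.
rewrite big_cons; set M := \big[_/_]_(_ <- _) _ in M0 Mub Mat *.
have cmp : (`|a| >=< M)%O by apply: real_comparable; rewrite ?normr_real ?ger0_real.
have [le_aM | lt_Ma] := comparable_leP cmp.
  split=> // [z | _].
    by rewrite inE => /predU1P[->|/Mub].
  case: (s =P [::]) => [s0 | /eqP /Mat[z zs <-]]; last by exists z; rewrite ?inE ?zs ?orbT.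
  exists a; rewrite ?mem_head //; apply/le_anti; rewrite le_aM /=.
  by rewrite /M s0 big_nil normr_ge0.
split=> // [z|_].
  by rewrite inE => /predU1P[->//|/Mub /le_trans]; apply; exact: ltW.
by exists a; rewrite ?mem_head.
Qed.

Lemma char_poly_rootsP n (A : 'M[algC]_n) z :
  (z \in sval (closed_field_poly_normal (char_poly A))) = eigenvalue A z.
Proof.
case: closed_field_poly_normal => s /= Hs.
by rewrite eigenvalue_root_char Hs (monicP (char_poly_monic A)) scale1r root_prod_XsubC.
Qed.

Section RealSymmetric.
Variables (n : nat) (A : 'M[algC]_n).
Hypotheses (Asym : A^T = A) (Areal : A \is a realmx).

Let P := spectralmx A.
Let d := spectral_diag A.
Let rho := spectral_radius A.

Let Aherm : A \is hermsymmx.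
Proof. by apply: realsym_hermsym => //; apply/is_hermitianmxP; rewrite expr0 scale1r map_mx_id ?Asym. Qed.

Let AE : A = P^t* *m diag_mx d *m P.
Proof.
have /orthomx_spectralP := hermitian_normalmx Aherm.
by rewrite invmx_unitary ?spectral_unitarymx.
Qed.

Let PtP : P^t* *m P = 1%:M.
Proof. by rewrite -(invmx_unitary (spectral_unitarymx A)) mulVmx ?spectral_unit. Qed.

Let PPt : P *m P^t* = 1%:M.
Proof. exact/unitarymxP/spectral_unitarymx. Qed.

Let PA : P *m A = diag_mx d *m P.
Proof. by rewrite {1}AE !mulmxA PPt mul1mx. Qed.

Lemma spectral_diag_le_radius i : d 0 i <= rho.
Proof.
have dreal : d 0 i \is Num.real by have /mxOverP := hermitian_spectral_diag_real Aherm; apply.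
apply: le_trans (real_ler_norm dreal) _.
have [_ + _] := bigmax_norm_spec (sval (closed_field_poly_normal (char_poly A))).
apply; rewrite char_poly_rootsP; apply/eigenvalueP; exists (row i P).
  by rewrite -row_mul PA; apply/rowP => j; rewrite mul_diag_mx !mxE.
have /unitarymxP := spectral_unitarymx A => /matrixP /(_ i i).
rewrite -/P !mxE eqxx => H; apply/eqP => Pi0; move: H.
rewrite big1 => [/eqP|j _]; first by rewrite eq_sym oner_eq0.
by have := congr1 (fun M : 'rV_n => M 0 j) Pi0; rewrite !mxE => ->; rewrite mul0r.
Qed.

Let quad (z : 'rV[algC]_n) : algC := (z *m A *m z^t*) 0 0.
Let nrm2 (z : 'rV[algC]_n) : algC := \sum_i `|z 0 i| ^+ 2.

Let nrm2E z : nrm2 z = (z *m z^t*) 0 0.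
Proof. by rewrite mxE; apply: eq_bigr => i _; rewrite !mxE normCK. Qed.

Let w (z : 'rV[algC]_n) := z *m P^t*.

Let nrm2_w z : nrm2 (w z) = nrm2 z.
Proof. by rewrite !nrm2E /w trmx_mul map_mxM trmxCK mulmxA -(mulmxA z) PtP mulmx1. Qed.

Let quadE z : quad z = \sum_i d 0 i * `|w z 0 i| ^+ 2.
Proof.
rewrite /quad {1}AE.
have -> : z *m (P^t* *m diag_mx d *m P) *m z^t* = w z *m diag_mx d *m (w z)^t*.
  by rewrite /w trmx_mul map_mxM trmxCK !mulmxA.
by rewrite mxE; apply: eq_bigr => i _; rewrite mul_mx_diag !mxE normCK; ring.
Qed.

Lemma rayleigh_le z : quad z <= rho * nrm2 z.
Proof.
rewrite -(nrm2_w z) mulr_sumr quadE; apply: ler_sum => i _.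
by rewrite ler_wpM2r ?exprn_ge0 ?spectral_diag_le_radius.
Qed.

(** The gap in the Rayleigh inequality is a sum of nonnegative terms in spectral coordinates; when
    it vanishes, only coordinates with eigenvalue [rho] survive. *)
Lemma rayleigh_eq z : quad z = rho * nrm2 z -> z *m A = rho *: z.
Proof.
rewrite -(nrm2_w z) mulr_sumr quadE => /esym /eqP.
rewrite -subr_eq0 -sumrB => /eqP S0.
have {S0} H i : rho * w z 0 i = d 0 i * w z 0 i.
  have pos j : xpredT j -> 0 <= rho * `|w z 0 j| ^+ 2 - d 0 j * `|w z 0 j| ^+ 2.
    by rewrite -mulrBl mulr_ge0 ?exprn_ge0 // subr_ge0 spectral_diag_le_radius.
  have /(_ i isT)/eqP := psumr_eq0P pos S0; rewrite -mulrBl.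
  rewrite mulf_eq0 expf_eq0 normr_eq0 /= => /orP[|/eqP ->]; last by rewrite !mulr0.
  by rewrite subr_eq0 => /eqP ->.
have -> : z = w z *m P by rewrite /w -mulmxA PtP mulmx1.
rewrite -mulmxA PA mulmxA scalemxAl; congr (_ *m _).
by apply/rowP => i; have := H i; rewrite mul_mx_diag !mxE mulrC => ->; rewrite mulrC.
Qed.

(** Taking moduli in an eigenvector whose eigenvalue has modulus [rho] cannot decrease the quadratic
    form, by the triangle inequality. The result therefore attains equality in the Rayleigh
    bound. *)
Lemma perron_vector : (0 < n)%N -> (forall i j, 0 <= A i j) ->
  exists z : 'rV[algC]_n, [/\ forall i, 0 <= z 0 i, z != 0 & z *m A = rho *: z].
Proof.
move=> n0 A0.
have [rho0 _ []] := bigmax_norm_spec (sval (closed_field_poly_normal (char_poly A))).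
  have [z] := eigenvalue_closed A n0.
  by rewrite -char_poly_rootsP; case: (sval _).
move=> mu; rewrite char_poly_rootsP => /eigenvalueP[v vA v0] mu_rho.
rewrite -/(spectral_radius A) -/rho in rho0 mu_rho.
pose z := \row_i `|v 0 i| : 'rV[algC]_n.
have nz : nrm2 z = nrm2 v by apply: eq_bigr => i _; rewrite mxE normr_id.
exists z; split=> [i||]; first by rewrite mxE.
  apply: contra v0 => /eqP /rowP z0; apply/eqP/rowP => i.
  by have := z0 i; rewrite !mxE => /eqP; rewrite normr_eq0 => /eqP.
apply: rayleigh_eq; apply/le_anti; rewrite rayleigh_le /= nz.
have -> : rho * nrm2 v = `|quad v|.
  rewrite /quad vA -scalemxAl mxE -nrm2E normrM mu_rho; congr (_ * _).
  by rewrite ger0_norm // sumr_ge0 // => i _; rewrite exprn_ge0.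
have qE y : quad y = \sum_i \sum_j y 0 j * A j i * (y 0 i)^*.
  by rewrite /quad !mxE; apply: eq_bigr => i _; rewrite !mxE mulr_suml.
rewrite !qE; apply: le_trans (ler_norm_sum _ _ _) _; apply: ler_sum => i _.
apply: le_trans (ler_norm_sum _ _ _) _; apply: ler_sum => j _.
by rewrite !normrM norm_conjC (ger0_norm (A0 _ _)) !mxE conj_normC.
Qed.

End RealSymmetric.

(** * Rayleigh quotients and Perron vectors of graphs *)

Lemma lambda_ge0 n (e : rel 'I_n) : 0 <= lambda e.
Proof. by have [] := bigmax_norm_spec (sval (closed_field_poly_normal (char_poly (adjmx e)))). Qed.

(** The order of [algC] is partial; moving to its real subfield gives a totally ordered field, where
    [lra] applies. *)
Definition lambdaR n (e : rel 'I_n) : algR := in_algR (ger0_real (lambda_ge0 e)).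

Lemma adjmx_sym n (e : rel 'I_n) : symmetric e -> (adjmx e)^T = adjmx e.
Proof. by move=> sym_e; apply/matrixP => i j; rewrite !mxE sym_e. Qed.

Lemma adjmx_real n (e : rel 'I_n) : adjmx e \is a realmx.
Proof. by apply/mxOverP => i j; rewrite mxE realn. Qed.

Lemma rayleigh_graph n (e : rel 'I_n) (z : 'I_n -> algR) : symmetric e ->
  \sum_i \sum_j (e i j)%:R * (z i * z j) <= lambdaR e * \sum_i z i ^+ 2.
Proof.
move=> sym_e.
have := rayleigh_le (adjmx_sym sym_e) (adjmx_real e) (\row_i val (z i)).
set a := (X in X <= _); set b := (X in _ <= X) => le_ab.
set a' := (X in X <= _); set b' := (X in _ <= X).
suff [Ea Eb] : a = algRval a' /\ b = algRval b' by rewrite Ea Eb in le_ab.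
split.
  rewrite /a mxE rmorph_sum; apply: eq_bigr => i _; rewrite !mxE mulr_suml rmorph_sum.
  apply: eq_bigr => j _; rewrite !mxE (CrealP (algRvalP _)) !rmorphM rmorph_nat.
  by rewrite sym_e; ring.
rewrite /b rmorphM rmorph_sum; congr (_ * _); apply: eq_bigr => i _.
by rewrite mxE rmorphXn /= real_normK // algRvalP.
Qed.

Lemma perron_graph n (e : rel 'I_n) : (0 < n)%N -> symmetric e ->
  exists z : 'I_n -> algR, [/\ forall i, 0 <= z i, exists i, z i != 0
    & forall i, \sum_j (e i j)%:R * z j = lambdaR e * z i].
Proof.
move=> n0 sym_e.
have [|z [z0 znz zA]] := perron_vector (adjmx_sym sym_e) (adjmx_real e) n0.
  by move=> i j; rewrite mxE ler0n.
exists (fun i => in_algR (ger0_real (z0 i))); split=> [i||i].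
- exact: z0.
- have [i zi0] : exists i, z 0 i != 0 by apply/rV0Pn.
  by exists i; apply: contra zi0 => /eqP /(congr1 algRval) /= ->.
apply: val_inj => /=; rewrite rmorph_sum; have /rowP/(_ i) := zA.
rewrite !mxE => <-; apply: eq_bigr => j _.
by rewrite rmorphM rmorph_nat /= mxE sym_e mulrC.
Qed.

Local Close Scope sesquilinear_scope.

Lemma sum_pushforward (R : comPzRingType) (I J : finType) (P : pred I) (f : I -> J)
    (v : I -> R) (g : J -> R) :
  \sum_y (\sum_(x | P x && (f x == y)) v x) * g y = \sum_(x | P x) v x * g (f x).
Proof.
rewrite [RHS](partition_big f xpredT) //=; apply: eq_bigr => y _.
by rewrite mulr_suml; apply: eq_bigr => x /andP[_ /eqP ->].
Qed.

Lemma lambda_edgeless n (e : rel 'I_n) : (forall x y, ~~ e x y) -> lambda e = 0.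
Proof.
move=> e0; have A0 : adjmx e = 0 by apply/matrixP => i j; rewrite !mxE (negPf (e0 i j)).
have [_ _ Mat] := bigmax_norm_spec (sval (closed_field_poly_normal (char_poly (adjmx e)))).
case: (sval _ =P [::]) Mat => [s0 _|_ /(_ isT)[z]].
  by rewrite /lambda /spectral_radius s0 big_nil.
rewrite char_poly_rootsP => /eigenvalueP[v vA v0] Mz.
rewrite /lambda /spectral_radius -Mz.
move: vA; rewrite A0 mulmx0 => /esym/eqP; rewrite scalemx_eq0 (negPf v0) orbF => /eqP ->.
by rewrite normr0.
Qed.

(** A Perron vector of [e1] pushed forward along [f] is a test vector for [e2]. When the eigenvalue
    is positive the vector vanishes at isolated vertices, so injectivity on the others preserves its
    norm. *)
Lemma lambda_le_embed n1 n2 (e1 : rel 'I_n1) (e2 : rel 'I_n2) (f : 'I_n1 -> 'I_n2) :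
    symmetric e1 -> symmetric e2 ->
    {in nonisolated e1 &, injective f} ->
    (forall x y, e1 x y -> e2 (f x) (f y)) ->
  lambda e1 <= lambda e2.
Proof.
move=> sym1 sym2 finj fhom; change (lambdaR e1 <= lambdaR e2).
have L2 : 0 <= lambdaR e2 by exact: lambda_ge0.
have [L1|L1] := leP (lambdaR e1) 0; first exact: le_trans L1 L2.
case: n1 => [|n1] in e1 f sym1 finj fhom L1 *.
  have : 0 < lambda e1 by exact: L1.
  by rewrite lambda_edgeless ?ltxx // => -[].
have [v [v0 [i0 vi0] vE]] := perron_graph (ltn0Sn n1) sym1.
pose P := nonisolated e1.
have e1P x y : e1 x y -> P x by move=> exy; apply/existsP; exists y.
have vP x : ~~ P x -> v x = 0.
  move=> nPx; have := vE x; rewrite big1 => [/esym/eqP|y _].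
    by rewrite mulf_eq0 (gt_eqF L1) => /eqP.
  by case exy: (e1 x y); rewrite ?mul0r //; move: nPx; rewrite (e1P _ _ exy).
pose z y := \sum_(x | P x && (f x == y)) v x.
have zf x : P x -> z (f x) = v x.
  move=> Px; rewrite /z (bigD1 x) ?Px ?eqxx //= big1 ?addr0 // => y.
  by case/andP=> /andP[Py /eqP fyx]; rewrite (finj _ _ Py Px fyx) eqxx.
have nrmE : \sum_y z y ^+ 2 = \sum_x v x ^+ 2.
  under eq_bigr => y _ do rewrite expr2 {1}/z.
  rewrite sum_pushforward [RHS](bigID P) /= [X in _ + X]big1 ?addr0.
    by apply: eq_bigr => x Px; rewrite zf.
  by move=> x /vP ->; rewrite expr0n.
have := rayleigh_graph z sym2; rewrite nrmE => ray.
have v2 : 0 < \sum_x v x ^+ 2.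
  rewrite (bigD1 i0) //= ltr_pwDl ?sumr_ge0 // => [|i _]; last exact: sqr_ge0.
  by rewrite exprn_even_gt0 //= vi0.
rewrite -(ler_pM2r v2); apply: le_trans ray.
have -> : lambdaR e1 * \sum_x v x ^+ 2 = \sum_x \sum_y (e1 x y)%:R * (v x * v y).
  rewrite mulr_sumr; apply: eq_bigr => x _.
  by rewrite expr2 mulrA -vE mulr_suml; apply: eq_bigr => y _; ring.
have -> : \sum_y \sum_y' (e2 y y')%:R * (z y * z y') =
    \sum_(x | P x) v x * \sum_(x' | P x') v x' * (e2 (f x) (f x'))%:R.
  rewrite -(sum_pushforward P f v
    (fun y => \sum_(x' | P x') v x' * (e2 y (f x'))%:R)).
  apply: eq_bigr => y _; rewrite -(sum_pushforward P f v (fun y' => (e2 y y')%:R)).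
  by rewrite mulr_sumr; apply: eq_bigr => y' _; rewrite /z; ring.
rewrite [leLHS](bigID P) /= [X in _ + X]big1 ?addr0; last first.
  by move=> x /vP ->; rewrite big1 // => y _; rewrite mul0r mulr0.
apply: ler_sum => x _; rewrite mulr_sumr [leLHS](bigID P) /= [X in _ + X]big1 ?addr0.
  apply: ler_sum => y _; case exy : (e1 x y); first by rewrite fhom //; lra.
  by rewrite mul0r !mulr_ge0 ?ler0n.
by move=> y /vP ->; rewrite !mulr0.
Qed.

Lemma lambda_iso n1 n2 (e1 : rel 'I_n1) (e2 : rel 'I_n2) :
  symmetric e1 -> symmetric e2 -> iso_up_to_isolated e1 e2 -> lambda e1 = lambda e2.
Proof.
move=> sym1 sym2 [f [finj fni fsurj fE]].
have e1P (x y : 'I_n1) : e1 x y -> nonisolated e1 x by move=> h; apply/existsP; exists y.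
have e2P (x y : 'I_n2) : e2 x y -> nonisolated e2 x by move=> h; apply/existsP; exists y.
apply/le_anti/andP; split.
  apply: (@lambda_le_embed _ _ _ _ f) => // x y exy.
  rewrite -fE //; first exact: e1P exy.
  by rewrite sym1 in exy; exact: e1P exy.
case: n1 => [|n1] in e1 f sym1 finj fni fsurj fE e1P *.
  rewrite (lambda_edgeless (e := e2)) ?lambda_ge0 // => x y.
  by apply/negP => /e2P/fsurj[[]].
(* An inverse of [f] on nonisolated vertices; the default [ord0] is why the empty vertex set is
   treated separately. *)
pose g y := odflt ord0 [pick x | nonisolated e1 x && (f x == y)].
have gP y : nonisolated e2 y -> nonisolated e1 (g y) /\ f (g y) = y.
  move=> /fsurj[x nx fx]; rewrite /g; case: pickP => [z /andP[nz /eqP]|/(_ x)] //.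
  by rewrite nx fx eqxx.
apply: (@lambda_le_embed _ _ _ _ g) => // [x y /gP[_ {2}<-] /gP[_ {2}<-] -> //|x y exy].
have nx := e2P _ _ exy; have ny : nonisolated e2 y by rewrite sym2 in exy; exact: e2P exy.
by have [nx' fx] := gP _ nx; have [ny' fy] := gP _ ny; rewrite fE // fx fy.
Qed.

Lemma split_graph_sym k m : symmetric (split_graph k m).
Proof. by move=> i j; rewrite /split_graph eq_sym orbC. Qed.

Lemma big_ord_split3 (R : zmodType) k t (F : nat -> R) :
  \sum_(i < k + t + 1) F i = \sum_(i < k) F i + \sum_(i < t) F (k + i)%N + F (k + t)%N.
Proof.
rewrite big_split_ord /= big_ord1 addn0; congr (_ + _).
by rewrite big_split_ord.
Qed.

(** Rayleigh inequality for arbitrary entries on the clique, extended to the other vertices by the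
    eigenvalue equation with [l] in place of the spectral radius. The outer vertices count twice in
    the quadratic form and once in the norm, which leaves one copy of the fraction. *)
Lemma rayleigh_split k m (y : nat -> algR) (l : algR)
    (X := \sum_(i < k) y i) (Xs := \sum_(i < k | (i < split_s k m)%N) y i) :
  (0 < k)%N -> 0 < l -> lambdaR (split_graph k m) <= l ->
  X ^+ 2 - \sum_(i < k) y i ^+ 2 + ((split_t k m)%:R * X ^+ 2 + Xs ^+ 2) / l
    <= l * \sum_(i < k) y i ^+ 2.
Proof.
move=> k0 l0 le_l; set t := split_t k m; set s := split_s k m in Xs *.
have sk : (s < k)%N by rewrite ltn_mod.
pose z i := if (i < k)%N then y i else if (i < k + t)%N then X / l else Xs / l.
have zA i : (i < k)%N -> z i = y i by rewrite /z => ->.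
have zM i : (i < t)%N -> z (k + i)%N = X / l.
  by move=> it; rewrite /z ltnNge leq_addr /= ltn_add2l it.
have zL : z (k + t)%N = Xs / l by rewrite /z ltnNge leq_addr ltnn.
pose ad (i j : nat) : bool := (i != j) &&
  ([|| (i < k) && (j < k), (i < k) && (k <= j < k + t) | (j == k + t) && (i < s)] ||
   [|| (j < k) && (i < k), (j < k) && (k <= i < k + t) | (i == k + t) && (j < s)])%N.
have adE i j : split_graph k m i j = ad i j by [].
have sumA : \sum_(i < k) z i = X by apply: eq_bigr => i _; rewrite zA.
have rowA i : (i < k)%N ->
    \sum_(j < k + t + 1) (ad i j)%:R * z j = X - y i + t%:R * (X / l) + (i < s)%N%:R * (Xs / l).
  move=> ik; rewrite (big_ord_split3 k t (fun j => (ad i j)%:R * z j)); congr (_ + _ + _).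
  - rewrite -sumA (bigD1 (Ordinal ik)) //= [X in _ = X - _](bigD1 (Ordinal ik)) //=.
    rewrite {1}/ad eqxx mul0r add0r zA // [y i + _]addrC addrK; apply: eq_bigr => j ji.
    have -> : ad i j by rewrite /ad ik ltn_ord /= andbT eq_sym; exact: ji.
    by rewrite mul1r.
  - rewrite (eq_bigr (fun=> X / l)) ?sumr_const ?card_ord ?mulr_natl // => j _.
    have -> : ad i (k + j)%N by rewrite /ad ik leq_addr ltn_add2l ltn_ord /= orbT andbT; lia.
    by rewrite zM // mul1r.
  have -> : ad i (k + t)%N = (i < s)%N by rewrite /ad; lia.
  by rewrite zL.
have rowM i : (i < t)%N -> \sum_(j < k + t + 1) (ad (k + i) j)%:R * z j = X.
  move=> it; rewrite (big_ord_split3 k t (fun j => (ad (k + i) j)%:R * z j)).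
  rewrite [X in _ + X + _]big1 ?addr0 => [|j _].
    have -> : ad (k + i) (k + t) = false by rewrite /ad; lia.
    rewrite mul0r addr0 -[RHS]sumA; apply: eq_bigr => j _.
    have -> : ad (k + i) j by have := ltn_ord j; rewrite /ad; lia.
    by rewrite mul1r.
  have -> : ad (k + i) (k + j) = false by have := ltn_ord j; rewrite /ad; lia.
  by rewrite mul0r.
have rowL : \sum_(j < k + t + 1) (ad (k + t) j)%:R * z j = Xs.
  rewrite (big_ord_split3 k t (fun j => (ad (k + t) j)%:R * z j)).
  rewrite [X in _ + X + _]big1 ?addr0 => [|j _].
    have -> : ad (k + t) (k + t) = false by rewrite /ad; lia.
    rewrite mul0r addr0 [RHS]big_mkcond; apply: eq_bigr => j _.
    have -> : ad (k + t) j = (j < s)%N by have := ltn_ord j; rewrite /ad; lia.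
    by rewrite zA //; case: (j < s)%N; rewrite ?mul1r ?mul0r.
  have -> : ad (k + t) (k + j) = false by have := ltn_ord j; rewrite /ad; lia.
  by rewrite mul0r.
have := rayleigh_graph (fun i : 'I_(k + t + 1) => z i) (@split_graph_sym k m).
set Q := (Y in Y <= _); set P := \sum_i _ => ray.
have PE : P = \sum_(i < k) y i ^+ 2 + t%:R * (X / l) ^+ 2 + (Xs / l) ^+ 2.
  rewrite /P (big_ord_split3 k t (fun i => z i ^+ 2)) zL; congr (_ + _ + _).
    by apply: eq_bigr => i _; rewrite zA.
  rewrite (eq_bigr (fun=> (X / l) ^+ 2)) ?sumr_const ?card_ord ?mulr_natl // => i _.
  by rewrite zM.
have QE : Q = X ^+ 2 - \sum_(i < k) y i ^+ 2 + 2 * (t%:R * (X ^+ 2 / l) + Xs ^+ 2 / l).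
  have -> : Q = \sum_(i < k + t + 1) z i * \sum_(j < k + t + 1) (ad i j)%:R * z j.
    apply: eq_bigr => i _; rewrite mulr_sumr; apply: eq_bigr => j _; rewrite adE.
    by rewrite [RHS]mulrCA.
  rewrite (big_ord_split3 k t (fun i => z i * \sum_(j < k + t + 1) (ad i j)%:R * z j)).
  rewrite rowL zL.
  have -> : \sum_(i < t) z (k + i)%N * \sum_(j < k + t + 1) (ad (k + i) j)%:R * z j =
      t%:R * (X ^+ 2 / l).
    rewrite (eq_bigr (fun=> X ^+ 2 / l)) ?sumr_const ?card_ord ?mulr_natl // => i _.
    by rewrite zM // rowM //; ring.
  have -> : \sum_(i < k) z i * \sum_(j < k + t + 1) (ad i j)%:R * z j =
      X ^+ 2 - \sum_(i < k) y i ^+ 2 + t%:R * (X ^+ 2 / l) + Xs ^+ 2 / l.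
    rewrite (eq_bigr (fun i : 'I_k => y i * X - y i ^+ 2 + y i * (t%:R * (X / l)) +
               (if (i < s)%N then y i else 0) * (Xs / l))).
      rewrite !big_split /= sumrN -!mulr_suml -big_mkcond /= -/X -/Xs; ring.
    move=> i _; rewrite rowA // zA //; case: (i < s)%N; rewrite ?mul1r ?mul0r; ring.
  ring.
have P0 : 0 <= P by apply: sumr_ge0 => i _; apply: sqr_ge0.
have : Q <= l * P by apply: le_trans ray _; rewrite ler_wpM2r.
rewrite QE PE => main.
have e1 : l * (t%:R * (X / l) ^+ 2) = t%:R * (X ^+ 2 / l) by field; rewrite gt_eqF.
have e2 : l * (Xs / l) ^+ 2 = Xs ^+ 2 / l by field; rewrite gt_eqF.
move: main; rewrite !mulrDr e1 e2 mulrDl -mulrA; lra.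
Qed.

(** * Hubs of a graph with large spectral radius *)

Lemma subset_with_card (T : finType) (B : {set T}) y j : y \in B -> (j < #|B|)%N ->
  exists C : {set T}, [/\ C \subset B, y \in C & #|C| = j.+1].
Proof.
move: {2}#|B| (erefl #|B|) => n; elim: n B => [|n IH] B cB yB jB.
  by move: jB; rewrite cB.
have [eqj|neq] := eqVneq #|B| j.+1; first by exists B.
have /card_gt0P[z] : (0 < #|B :\ y|)%N by have := cardsD1 y B; rewrite yB; lia.
rewrite !inE => /andP[zy zB].
have cz : #|B :\ z| = n by have := cardsD1 z B; rewrite zB; lia.
have [||C [CB yC cC]] := IH (B :\ z) cz; first by rewrite !inE eq_sym zy.
  by lia.
by exists C; split=> //; apply: subset_trans CB (subsetDl _ _).
Qed.

Section Core.
Variables (R : realFieldType) (T : finType) (e : rel T) (x : T -> R) (lam : R) (u : T).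
Hypotheses (sym_e : symmetric e) (irr_e : irreflexive e).
Hypotheses (x_ge0 : forall v, 0 <= x v) (x_le1 : forall v, x v <= 1) (xu : x u = 1).
Hypothesis (eig : forall v, \sum_w (e v w)%:R * x w = lam * x v).
Variables (h k : nat).
Hypotheses (k_gt0 : (0 < k)%N) (deg : degenerate_links e h) (thin : thin_bicliques e h k).

Let E v w : R := (e v w)%:R.
Let N := [set v | e u v].
Let W := [set w | (w != u) && ~~ e u w].

Let E_ge0 v w : 0 <= E v w. Proof. exact: ler0n. Qed.
Let E_sym v w : E v w = E w v. Proof. by rewrite /E sym_e. Qed.

Lemma sum_nbhd_split F : \sum_v F v = F u + \sum_(v in N) F v + \sum_(v in W) F v :> R.
Proof.
rewrite (bigD1 u) //= -addrA; congr (_ + _); rewrite (bigID (e u)) /=; congr (_ + _).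
  by apply: eq_bigl => v; rewrite inE; case: eqP => // ->; rewrite irr_e.
by apply: eq_bigl => v; rewrite inE.
Qed.

Lemma lam_sum_nbrs : lam = \sum_(v in N) x v.
Proof.
rewrite -[LHS]mulr1 -xu -eig [RHS]big_mkcond; apply: eq_bigr => v _.
by rewrite inE; case: (e u v); rewrite ?mul1r ?mul0r.
Qed.

Let pp (t : R) := if 0 <= t then t else 0.
Let pp_ge0 t : 0 <= pp t. Proof. by rewrite /pp; case: ifP. Qed.
Let ppB t : pp t - pp (- t) = t.
Proof. by rewrite /pp oppr_ge0; case: (ltgtP t 0) => h0; lra. Qed.
Let pp_le t s : 0 <= s -> t <= s -> pp t <= s.
Proof. by rewrite /pp; case: ifP. Qed.
Let pp_ge t : t <= pp t.
Proof. by rewrite /pp; case: (leP 0 t) => // /ltW. Qed.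

Let g v w := x v + x w - 1.
(** The sums run over ordered pairs, hence the factor one half. [pp] is the positive part, so
    [gain - slack] is the sum of [g] over the edges inside [N]. *)
Let gain := 2^-1 * \sum_(v in N) \sum_(w in N) E v w * pp (g v w).
Let slack := 2^-1 * \sum_(v in N) \sum_(w in N) E v w * pp (- g v w).
Let dN w := \sum_(v in N) E w v.
Let dW w := \sum_(v in W) E w v.
Let loss := slack + \sum_(w in W) dN w * (1 - x w) + 2^-1 * \sum_(w in W) dW w.
Let link_weight y := \sum_(v in N) E y v * x v.

Let m : R := 2^-1 * \sum_v \sum_w E v w.

(** Since [x u = 1], applying the eigenvalue equation twice at [u] weighs the walks of length two by
    their last vertex. Subtracting the edges, sorted by how they meet [u], [N] and [W], gives the
    identity. *)
Lemma lam_sqr_identity : lam ^+ 2 - m = gain - loss.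
Proof.
pose cN : R := \sum_(v in N) 1.
pose SNx := \sum_(v in N) \sum_(w in N) E v w * x w.
pose SN := \sum_(v in N) \sum_(w in N) E v w.
pose SWx := \sum_(w in W) dN w * x w.
pose SW := \sum_(w in W) dN w.
pose SWW := \sum_(w in W) dW w.
have EuN v : v \in N -> E v u = 1 by rewrite inE /E sym_e => ->.
have EuW v : v \in W -> E v u = 0 by rewrite inE /E sym_e => /andP[_ /negPf ->].
have l2 : lam ^+ 2 = cN + SNx + SWx.
  rewrite expr2 {2}lam_sum_nbrs mulr_sumr.
  under eq_bigr => v _ do rewrite -eig sum_nbhd_split.
  rewrite !big_split /=; congr (_ + _ + _).
    by apply: eq_bigr => v vN; rewrite -/(E v u) EuN // xu mulr1.
  rewrite exchange_big; apply: eq_bigr => w _; rewrite mulr_suml.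
  by apply: eq_bigr => v _; rewrite E_sym.
have m2 : 2 * m = 2 * cN + SN + 2 * SW + SWW.
  rewrite /m mulrA divff ?mul1r ?pnatr_eq0 // sum_nbhd_split.
  have -> : \sum_w E u w = cN.
    rewrite /cN [RHS]big_mkcond; apply: eq_bigr => v _; rewrite inE /E; by case: (e u v).
  have -> : \sum_(v in N) \sum_w E v w = cN + SN + SW.
    under eq_bigr => v _ do rewrite sum_nbhd_split.
    rewrite !big_split /=; congr (_ + _ + _); first by apply: eq_bigr => v /EuN.
    rewrite exchange_big; apply: eq_bigr => w _.
    by apply: eq_bigr => v _; rewrite E_sym.
  have -> : \sum_(v in W) \sum_w E v w = SW + SWW.
    under eq_bigr => v _ do rewrite sum_nbhd_split.
    by rewrite !big_split /= big1 ?add0r // => v /EuW.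
  by ring.
have GG : gain - slack = 2^-1 * (2 * SNx - SN).
  rewrite /gain /slack -mulrBr; congr (_ * _); rewrite -sumrB.
  under eq_bigr => v _ do rewrite -sumrB.
  under eq_bigr => v _ do under eq_bigr => w _ do
    rewrite -mulrBr ppB /g mulrBr mulrDr mulr1.
  have sx : \sum_(v in N) \sum_(w in N) E v w * x v = SNx.
    by rewrite exchange_big; apply: eq_bigr => v _; apply: eq_bigr => w _; rewrite E_sym.
  under eq_bigr => v _ do rewrite sumrB big_split /=.
  by rewrite sumrB big_split /= sx -/SNx -/SN; ring.
have DE : \sum_(w in W) dN w * (1 - x w) = SW - SWx.
  by rewrite -sumrB; apply: eq_bigr => w _; ring.
rewrite /loss DE -/SWW l2; lra.
Qed.

Let dN_ge0 w : 0 <= dN w. Proof. exact: sumr_ge0. Qed.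
Let dW_ge0 w : 0 <= dW w. Proof. exact: sumr_ge0. Qed.
Let slack_ge0 : 0 <= slack.
Proof. by rewrite mulr_ge0 ?invr_ge0 ?ler0n // !sumr_ge0 // => v _; rewrite sumr_ge0 // => w _; rewrite mulr_ge0. Qed.

(** Vertices of degree less than [h] are removed one at a time, each edge being charged to the
    endpoint removed first; ordered pairs account for the factor 2. *)
Lemma degenerate_sum (S : {set T}) (w : T -> R) (F : T -> T -> R) :
    S \subset N -> (forall v, 0 <= w v) ->
    (forall v y, v \in S -> y \in S -> F v y <= w v /\ F v y <= w y) ->
  \sum_(v in S) \sum_(y in S) E v y * F v y <= 2 * h%:R * \sum_(v in S) w v.
Proof.
move: {2}#|S| (erefl #|S|) => n; elim: n S => [|n IH] S cS SN w0 Fw.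
  by rewrite (cards0_eq cS) !big_set0 mulr0.
have S0 : S != set0 by rewrite -card_gt0 cS.
have [|v vS dv] := @deg u S S0; first by move=> v /(subsetP SN); rewrite inE.
have sub : S :\ v \subset S by exact: subsetDl.
have cS' : #|S :\ v| = n by have := cardsD1 v S; rewrite vS cS => -[].
have := IH _ cS' (subset_trans sub SN) w0 (fun a b ha hb => Fw a b (subsetP sub _ ha) (subsetP sub _ hb)).
have rm G : \sum_(y in S) G y = G v + \sum_(y in S :\ v) G y :> R.
  by rewrite (big_setD1 v).
rewrite (rm w) (rm (fun v => _)).
under [X in _ -> _ + X <= _]eq_bigr => y _ do rewrite (rm (fun z => _)).
rewrite big_split /=.
set d := #|_| in dv.
have dE : \sum_(y in S) E v y = d%:R.
  rewrite /d -sum1_card natr_sum [RHS]big_mkcond [LHS]big_mkcond; apply: eq_bigr => y _.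
  by rewrite inE /E; case: (y \in S); case: (e v y).
have b1 : \sum_(y in S) E v y * F v y <= h%:R * w v.
  apply: (@le_trans _ _ (d%:R * w v)); last by rewrite ler_wpM2r // ler_nat ltnW.
  rewrite -dE mulr_suml; apply: ler_sum => y yS.
  by rewrite ler_wpM2l //; case: (Fw v y vS yS).
have b2 : \sum_(y in S :\ v) E y v * F y v <= h%:R * w v.
  apply: (@le_trans _ _ (d%:R * w v)); last by rewrite ler_wpM2r // ler_nat ltnW.
  rewrite -dE mulr_suml (rm (fun y => _)) /E irr_e mul0r add0r; apply: ler_sum => y /(subsetP sub) yS.
  by rewrite sym_e ler_wpM2l //; case: (Fw y v yS vS).
by move: b1 b2; lra.
Qed.

Let g_le v w : pp (g v w) <= x v /\ pp (g v w) <= x w.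
Proof. by split; apply: pp_le => //; rewrite /g; have := x_le1 v; have := x_le1 w; lra. Qed.

Lemma gain_le : gain <= h%:R * lam.
Proof.
have := @degenerate_sum N x (fun v w => pp (g v w)) (subxx _) x_ge0 (fun v w _ _ => g_le v w).
rewrite -lam_sum_nbrs /gain; lra.
Qed.

(** [C0] is the additive error in the lower bound on [lam ^+ 2], [e1] the proportion of weight a hub
    may miss, and [eps] the threshold for a large entry in [W]. The hypotheses make [eps] small
    compared with [e1], and [e1] small in terms of [h] and [k]. *)
Variables (C0 e1 eps : R).
Hypothesis lam2_ge : m + (k%:R - 1) * lam - C0 <= lam ^+ 2.
Hypotheses (C0_ge0 : 0 <= C0) (e1_gt0 : 0 < e1) (eps_gt0 : 0 < eps) (eps_le : eps <= 1 / 2).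
Let H : R := h%:R + 1.
Hypothesis e1_small : H * (k%:R + 1) * e1 <= 1 / 8.
Hypothesis eps_small : 3 * H * eps <= e1 / 8.
Hypotheses (lam1 : 1 <= lam) (lamC0 : 4 * C0 <= lam) (lamh : 2 * h%:R <= lam).

Let H_ge1 : 1 <= H. Proof. by rewrite /H lerDr ler0n. Qed.
Let k_ge1 : 1 <= k%:R :> R. Proof. by rewrite ler1n. Qed.

Lemma loss_le_gain : loss + (k%:R - 1) * lam <= gain + C0.
Proof. by have := lam_sqr_identity; move: lam2_ge; lra. Qed.

Lemma loss_le : loss <= H * lam.
Proof.
have := loss_le_gain; have := gain_le; have : 0 <= (k%:R - 1) * lam by apply: mulr_ge0; move: k_ge1 lam1; lra.
by move: lamC0 C0_ge0; rewrite /H; lra.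
Qed.

Let DW_ge0 : 0 <= \sum_(w in W) dN w * (1 - x w).
Proof. by apply: sumr_ge0 => w _; rewrite mulr_ge0 // subr_ge0. Qed.
Let DWW_ge0 : 0 <= 2^-1 * \sum_(w in W) dW w.
Proof. by rewrite mulr_ge0 ?invr_ge0 ?ler0n // sumr_ge0. Qed.
Let loss_ge0 : 0 <= loss. Proof. by rewrite /loss; move: slack_ge0 DW_ge0 DWW_ge0; lra. Qed.

Let hubs := [set y | (1 - e1) * lam <= link_weight y].

Let aN_u : link_weight u = lam.
Proof. by rewrite lam_sum_nbrs; apply: eq_bigr => v; rewrite inE /E => ->; rewrite mul1r. Qed.

Let uA : u \in hubs.
Proof.
rewrite inE aN_u; have : 0 <= e1 * lam by apply: mulr_ge0; move: e1_gt0 lam1; lra.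
by lra.
Qed.

(** The common neighbourhood [Y] of [k + 1] hubs carries most of the weight, so [thin] applies: each
    vertex of [N] has at most one neighbour in [Y], and [k >= 2]. Then [gain] is little more than
    [lam / 2], while it must be at least about [(k - 1) * lam]. *)
Lemma card_hubs_le : (#|hubs| <= k)%N.
Proof.
rewrite leqNgt; apply/negP => kA.
have [B [BA uB cB]] := subset_with_card uA kA.
pose Y := [set y | [forall b in B, e b y]].
have YN : Y \subset N by apply/subsetP => y; rewrite !inE => /forall_inP/(_ _ uB).
pose N0 := N :\: Y.
have NY (F : T -> R) : \sum_(v in N) F v = \sum_(v in Y) F v + \sum_(v in N0) F v.
  rewrite (big_setID Y) /=; congr (_ + _); apply: eq_bigl => v; rewrite inE.
  by case vY : (v \in Y); rewrite ?andbF // (subsetP YN).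
(* Each vertex of [N0] is missed by some hub of [B], and each hub misses weight at most
   [e1 * lam]. *)
have sN0 : \sum_(v in N0) x v <= (k%:R + 1) * e1 * lam.
  apply: (@le_trans _ _ (\sum_(b in B) (lam - link_weight b))); last first.
    apply: (@le_trans _ _ (\sum_(b in B) e1 * lam)).
      by apply: ler_sum => b /(subsetP BA); rewrite inE; lra.
    by rewrite sumr_const cB -[leLHS]mulr_natl -natr1 mulrA.
  have -> : \sum_(b in B) (lam - link_weight b) = \sum_(v in N) x v * \sum_(b in B) (1 - E b v).
    under [RHS]eq_bigr => v _ do rewrite mulr_sumr.
    rewrite exchange_big; apply: eq_bigr => b _; rewrite lam_sum_nbrs /link_weight -sumrB.
    by apply: eq_bigr => v _; ring.
  have t0 v b : 0 <= 1 - E b v by rewrite /E; case: (e b v) => /=; lra.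
  rewrite [leRHS]NY -[leLHS]add0r lerD //.
    by apply: sumr_ge0 => v _; rewrite mulr_ge0 // sumr_ge0.
  apply: ler_sum => v; rewrite !inE negb_forall_in => /andP[/exists_inP[b bB nbv] _].
  rewrite -[leLHS]mulr1 ler_wpM2l // (bigD1 b) //= {1}/E (negPf nbv) subr0.
  by rewrite lerDl sumr_ge0.
have e1k : (k%:R + 1) * e1 * lam <= lam / 8.
  have h1 : 1 * ((k%:R + 1) * e1) <= H * ((k%:R + 1) * e1).
    by apply: ler_wpM2r => //; apply: mulr_ge0; move: k_ge1 e1_gt0; lra.
  have : ((k%:R + 1) * e1) * lam <= (1 / 8) * lam by apply: ler_wpM2r; move: h1 e1_small lam1; lra.
  by lra.
have lamNY := NY x; rewrite -lam_sum_nbrs in lamNY.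
have hY : (h <= #|Y|)%N.
  have : \sum_(v in Y) x v <= #|Y|%:R.
    by rewrite -sumr_const; apply: ler_sum.
  by rewrite -(ler_nat R); move: lamh lam1; lra.
have [||k1 uniqY] := @thin B Y u _ hY _ uB; first by rewrite cB.
  by move=> b y bB; rewrite inE => /forall_inP; apply.
have dY v : v \in N -> \sum_(w in Y) E v w <= 1.
  rewrite inE => uv; have [/existsP[w0 /andP[w0Y vw0]]|] := boolP [exists w, (w \in Y) && e v w].
    rewrite (bigD1 w0) //= {1}/E vw0 big1 ?addr0 // => w /andP[wY ww0]; rewrite /E.
    case vw: (e v w) => //; move: ww0.
    by rewrite (uniqY v w w0 uv wY w0Y vw vw0) eqxx.
  rewrite negb_exists => /forallP no; rewrite big1 // => w wY.
  by have := no w; rewrite wY /E /= => /negPf ->.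
have b1 : \sum_(v in Y) \sum_(w in Y) E v w * pp (g v w) <= lam.
  pose Q v w := E v w * x v.
  apply: (@le_trans _ _ (\sum_(v in Y) \sum_(w in Y) (Q v w + Q w v) / 2)).
    apply: ler_sum => v _; apply: ler_sum => w _; rewrite /Q (E_sym w v) -mulrDr -mulrA.
    by apply: ler_wpM2l => //; have [] := g_le v w; lra.
  have -> : \sum_(v in Y) \sum_(w in Y) (Q v w + Q w v) / 2 = \sum_(v in Y) \sum_(w in Y) Q v w.
    under eq_bigr => v _ do rewrite -mulr_suml big_split /=.
    rewrite -mulr_suml big_split /= [X in _ + X]exchange_big /=; lra.
  rewrite lamNY; apply: ler_wpDr; first exact: sumr_ge0.
  apply: ler_sum => v vY; rewrite /Q -mulr_suml -[leRHS]mul1r ler_wpM2r //.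
  exact: dY (subsetP YN _ vY).
have N0N : N0 \subset N by exact: subsetDl.
have b2 : \sum_(v in N0) \sum_(w in Y) E v w * pp (g v w) <= \sum_(v in N0) x v.
  apply: ler_sum => v vN0; rewrite -[leRHS]mul1r.
  apply: (@le_trans _ _ (\sum_(w in Y) E v w * x v)).
    by apply: ler_sum => w _; rewrite ler_wpM2l //; case: (g_le v w).
  by rewrite -mulr_suml ler_wpM2r // dY // (subsetP N0N).
have b3 := @degenerate_sum N0 x (fun v w => pp (g v w)) N0N x_ge0 (fun v w _ _ => g_le v w).
have b2' : \sum_(v in Y) \sum_(w in N0) E v w * pp (g v w) = \sum_(v in N0) \sum_(w in Y) E v w * pp (g v w).
  rewrite exchange_big; apply: eq_bigr => v _; apply: eq_bigr => w _.
  by rewrite E_sym /g (addrC (x w)).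
have GpE : gain <= lam / 2 + H * \sum_(v in N0) x v.
  rewrite /gain NY; under eq_bigr => v _ do rewrite NY.
  under [X in _ * (_ + X)]eq_bigr => v _ do rewrite NY.
  by rewrite !big_split /= b2' /H; move: b1 b2 b3; lra.
have k2 : 2 <= k%:R :> R by rewrite (ler_nat _ 2).
have kl : lam <= (k%:R - 1) * lam by rewrite -[leLHS]mul1r; apply: ler_wpM2r; move: lam1; lra.
have Hs : H * \sum_(v in N0) x v <= lam / 8.
  apply: (@le_trans _ _ (H * ((k%:R + 1) * e1 * lam))).
    by apply: ler_wpM2l => //; move: H_ge1; lra.
  have : (H * (k%:R + 1) * e1) * lam <= (1 / 8) * lam by apply: ler_wpM2r; move: e1_small lam1; lra.
  by lra.
by have := loss_le_gain; move: loss_ge0 lamC0 lam1 C0_ge0; lra.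
Qed.

Let e1_le : e1 <= 1 / 16.
Proof.
have h2 : 2 * e1 <= (k%:R + 1) * e1 by apply: ler_wpM2r; move: e1_gt0 k_ge1; lra.
have h1 : 1 * ((k%:R + 1) * e1) <= H * ((k%:R + 1) * e1).
  by apply: ler_wpM2r => //; move: h2 e1_gt0; lra.
by move: h1 h2 e1_small; lra.
Qed.
Let eps_le_e1 : eps <= e1 / 24.
Proof.
have h1 : 1 * eps <= H * eps by apply: ler_wpM2r => //; exact: ltW.
by move: h1 eps_small; lra.
Qed.

(** [kap] bounds the heavy vertices of [W] that are not hubs, [kapN] the heavy neighbours of [u],
    and [r5] the remaining contribution to [dN] at a vertex that is not a hub. *)
Variables (kap kapN r5 : R).
Hypothesis kap_ge : 4 * H <= kap * (eps * e1).
Hypothesis kapN_ge : 32 * h%:R <= kapN * e1.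
Let C5 := C0 + kapN ^+ 2.
Hypothesis r5_ge : 4 * C5 <= r5 * e1.
Hypotheses (lam_kap : 1 + k%:R + kap <= H * eps * lam) (lam_h : 32 * h%:R <= e1 * lam).
Hypotheses (lam_C5 : C5 < lam) (lam_r5 : r5 + kapN <= H * eps * lam).

Let lam_gt0 : 0 < lam. Proof. by move: lam1; lra. Qed.

Let heavyW := [set w in W | eps <= x w].

Let eigW w : lam * x w = E w u + link_weight w + \sum_(v in W) E w v * x v.
Proof. by rewrite -eig sum_nbhd_split xu mulr1. Qed.

Let aN_le_dN w : link_weight w <= dN w.
Proof. by apply: ler_sum => v _; rewrite -[leRHS]mulr1 ler_wpM2l. Qed.

(** There are at most [k] hubs, and every other heavy vertex of [W] costs a fixed multiple of [lam]
    in [loss], which is at most [H * lam]. *)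
Lemma card_heavy_outer : #|heavyW|%:R <= k%:R + kap.
Proof.
have big w : w \in heavyW :\: hubs -> eps * e1 / 4 * lam <= dN w * (1 - x w) + 2^-1 * dW w.
  rewrite !inE -ltNge => /andP[wA /andP[/andP[wu uw] xw]].
  have Ewu : E w u = 0 by rewrite /E sym_e (negPf uw).
  have := eigW w; rewrite Ewu add0r => eigw.
  have sW : \sum_(v in W) E w v * x v <= dW w.
    by apply: ler_sum => v _; rewrite -[leRHS]mulr1 ler_wpM2l.
  have dx : 0 <= dN w * (1 - x w) by rewrite mulr_ge0 // subr_ge0.
  have el : 0 <= eps * lam by apply: mulr_ge0; apply: ltW.
  have e1el : e1 * (eps * lam) <= 1 * (eps * lam) by apply: ler_wpM2r => //; move: e1_le; lra.
  (* If [w] has few neighbours in [W], the eigenvalue equation forces many in [N]; and since [w] is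
     not a hub, it also keeps [x w] away from 1. *)
  have [d_ge|d_lt] := leP (eps / 2 * lam) (dW w); first by move: d_ge dx e1el el; lra.
  have xwl : eps * lam <= x w * lam by apply: ler_wpM2r => //; apply: ltW.
  have d1 : eps / 2 * lam <= dN w by have := aN_le_dN w; move: eigw sW d_lt xwl; lra.
  have x1 : e1 / 2 <= 1 - x w.
    have : (x w - (1 - e1 + eps / 2)) * lam <= 0 by move: eigw sW d_lt wA; lra.
    by rewrite pmulr_lle0 //; move: eps_le_e1 e1_gt0; lra.
  have : eps / 2 * lam * (e1 / 2) <= dN w * (1 - x w).
    by apply: ler_pM => //; [move: el; lra|move: e1_gt0; lra].
  by have := dW_ge0 w; lra.
have sum_le : #|heavyW :\: hubs|%:R * (eps * e1 / 4 * lam) <= H * lam.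
  apply: le_trans loss_le; rewrite mulr_natl -sumr_const.
  apply: le_trans (ler_sum _ big) _.
  apply: (@le_trans _ _ (\sum_(w in W) (dN w * (1 - x w) + 2^-1 * dW w))).
    rewrite [leRHS](big_setID (heavyW :\: hubs)) /= -[leLHS]addr0 lerD //.
      rewrite le_eqVlt; apply/orP; left; apply/eqP; apply: eq_bigl => w.
      by rewrite !inE; case: (w != u); case: (e u w); rewrite ?andbF ?andbT.
    apply: sumr_ge0 => w _; rewrite addr_ge0 ?mulr_ge0 ?subr_ge0 ?invr_ge0 ?ler0n //.
  by rewrite big_split -mulr_sumr /loss /=; move: slack_ge0; lra.
have c1 : #|heavyW :\: hubs|%:R <= kap.
  have p1 : 0 < eps * e1 by apply: mulr_gt0.
  have : #|heavyW :\: hubs|%:R * (eps * e1 / 4) * lam <= H * lam by move: sum_le; lra.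
  rewrite ler_pM2r // => h1.
  rewrite -(ler_pM2r p1); move: h1 kap_ge; lra.
have : (#|heavyW| <= #|hubs| + #|heavyW :\: hubs|)%N.
  by rewrite -(cardsID hubs heavyW) leq_add2r subset_leq_card // subsetIr.
rewrite -(ler_nat R) natrD => h1.
have : #|hubs|%:R <= k%:R :> R by rewrite ler_nat card_hubs_le.
by move: c1 h1; lra.
Qed.

(** For [y] in [N], a light neighbour [w] in [W] has [1 - x w] at least one half and is paid for by
    the term of [dN w]; for [y] in [W], the edges are counted in [dW y]. *)
Lemma sum_light_outer_le y : \sum_(w in W :\: heavyW) E y w <= 2 * loss.
Proof.
have [yN|yN] := boolP (e u y).
  apply: (@le_trans _ _ (2 * \sum_(w in W) dN w * (1 - x w))); last first.
    by rewrite /loss; move: slack_ge0 DWW_ge0; lra.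
  rewrite [X in 2 * X](big_setID heavyW) /= mulrDr -[leLHS]add0r lerD //.
    by rewrite mulr_ge0 ?ler0n // sumr_ge0 // => w _; rewrite mulr_ge0 // subr_ge0.
  rewrite mulr_sumr; apply: ler_sum => w; rewrite !inE => /andP[nW wW].
  move: nW; rewrite wW /= -ltNge => xw.
  have : E y w <= dN w.
    rewrite E_sym /dN (bigD1 y) ?inE //= lerDl sumr_ge0 //.
  have : dN w * (1 / 2) <= dN w * (1 - x w).
    by apply: ler_wpM2l => //; move: xw eps_le; lra.
  by lra.
have [yu|yu] := eqVneq y u.
  rewrite big1; first by move: loss_ge0; lra.
  by move=> w; rewrite !inE yu /E => /and3P[_ _ /negPf ->].
apply: (@le_trans _ _ (dW y)).
  rewrite /dW [leRHS](big_setID heavyW) /= -[leLHS]add0r lerD //.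
  by apply: sumr_ge0.
apply: (@le_trans _ _ (\sum_(w in W) dW w)).
  by rewrite (bigD1 y) /= ?inE ?yu // lerDl sumr_ge0.
by rewrite /loss; move: slack_ge0 DW_ge0; lra.
Qed.

(** In the eigenvalue equation at [y], the vertex [u] and the heavy part of [W] contribute a bounded
    amount, and the light part at most [eps] times the preceding bound. *)
Lemma entry_le_link_weight y : lam * x y <= link_weight y + 3 * H * eps * lam.
Proof.
rewrite eigW; have Eyu : E y u <= 1 by rewrite /E; case: (e y u).
have : \sum_(w in W) E y w * x w <= #|heavyW|%:R + eps * (2 * loss).
  rewrite (big_setID heavyW) /= lerD //.
    apply: (@le_trans _ _ (\sum_(w in heavyW) 1)); last by rewrite sumr_const.
    have -> : W :&: heavyW = heavyW by apply/setIidPr/subsetP => w; rewrite inE => /andP[].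
    apply: ler_sum => w _; rewrite -[leRHS]mulr1 ler_pM //.
    by rewrite /E; case: (e y w).
  apply: (@le_trans _ _ (eps * \sum_(w in W :\: heavyW) E y w)); last first.
    by rewrite ler_wpM2l ?sum_light_outer_le // ltW.
  rewrite mulr_sumr; apply: ler_sum => w; rewrite !inE => /andP[nW wW].
  rewrite mulrC ler_wpM2r //; move: nW; rewrite wW /= -ltNge; exact: ltW.
have : eps * (2 * loss) <= eps * (2 * (H * lam)).
  by apply: ler_wpM2l; [exact: ltW | move: loss_le; lra].
by move: card_heavy_outer lam_kap Eyu; lra.
Qed.

Let heavyN := [set v in N | e1 / 4 <= x v].

Let entry_le_link_weight' y : lam * x y <= link_weight y + e1 / 8 * lam.
Proof.
apply: le_trans (entry_le_link_weight y) _; rewrite lerD2l; apply: ler_wpM2r; first exact: ltW.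
exact: eps_small.
Qed.

(** Every heavy neighbour has link weight at least [e1 / 8 * lam], whereas degeneracy bounds the
    total link weight by [2 * h] times [lam] plus their number, a term absorbed by [lam_h]. *)
Lemma card_heavy_nbrs : #|heavyN|%:R <= kapN.
Proof.
(* Weight 1 on heavy vertices is what lets [F v y = x y] be dominated at both ends. *)
pose w v := if v \in heavyN then 1 else x v.
have w0 v : 0 <= w v by rewrite /w; case: ifP.
have xw v : x v <= w v by rewrite /w; case: ifP.
have KNN : heavyN \subset N by apply/subsetP => v; rewrite inE => /andP[].
pose F v y := if v \in heavyN then x y else 0.
have Fw v y : v \in N -> y \in N -> F v y <= w v /\ F v y <= w y.
  by move=> _ _; rewrite /F {1}/w; case vK: (v \in heavyN).
have up := @degenerate_sum N w F (subxx _) w0 Fw.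
have split_w : \sum_(v in N) w v <= lam + #|heavyN|%:R.
  have -> : lam + #|heavyN|%:R = \sum_(v in N) x v + \sum_(v in heavyN) 1 by rewrite -lam_sum_nbrs sumr_const.
  have -> : \sum_(v in heavyN) 1 = \sum_(v in N) (v \in heavyN)%:R :> R.
    rewrite [RHS](big_setID heavyN) /= [X in _ + X]big1 ?addr0.
      have -> : N :&: heavyN = heavyN by apply/setIidPr.
      by apply: eq_bigr => v ->.
    by move=> v; rewrite inE => /andP[/negPf ->].
  rewrite -big_split /=; apply: ler_sum => v _; rewrite /w.
  by case: (v \in heavyN); rewrite ?addr0 // lerDr.
have low : #|heavyN|%:R * (e1 / 8 * lam) <=
    \sum_(v in N) \sum_(y in N) E v y * F v y.
  rewrite mulr_natl -sumr_const [leRHS](big_setID heavyN) /= -[leLHS]addr0 lerD //.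
    have -> : N :&: heavyN = heavyN by apply/setIidPr.
    apply: ler_sum => v vK; rewrite /F vK -/(link_weight v).
    have xv : e1 / 4 * lam <= x v * lam.
      by apply: ler_wpM2r; [exact: ltW|move: vK; rewrite inE => /andP[]].
    by have := entry_le_link_weight' v; move: xv; lra.
  by apply: sumr_ge0 => v _; apply: sumr_ge0 => y _; rewrite mulr_ge0 // /F; case: ifP.
have {up low} up := le_trans low up.
have : 2 * h%:R * \sum_(v in N) w v <= 2 * h%:R * (lam + #|heavyN|%:R).
  by rewrite ler_wpM2l ?mulr_ge0 ?ler0n.
have : #|heavyN|%:R * (32 * h%:R) <= #|heavyN|%:R * (e1 * lam) by rewrite ler_wpM2l ?ler0n.
move=> h1 h2; have : (#|heavyN|%:R * e1) * lam <= (32 * h%:R) * lam by move: up h1 h2; lra.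
rewrite ler_pM2r // => h3; rewrite -(ler_pM2r e1_gt0).
exact: le_trans h3 kapN_ge.
Qed.

Let x_notA y : y \notin hubs -> x y <= 1 - 7 / 8 * e1.
Proof.
rewrite inE -ltNge => yA; have := entry_le_link_weight' y => h1.
by rewrite -(ler_pM2l lam_gt0); move: yA h1; lra.
Qed.

(** A pair containing a hub is charged the entry of its other end. Without hubs, [g] can be positive
    only if both ends are heavy, and there are at most [kapN ^+ 2] such ordered pairs. *)
Lemma gain_le_hubs : gain <= #|hubs :&: N|%:R * lam + kapN ^+ 2.
Proof.
pose IA v : R := (v \in hubs)%:R; pose IK v : R := (v \in heavyN)%:R.
have b v w : v \in N -> w \in N ->
    E v w * pp (g v w) <= IA v * x w + IA w * x v + IK v * IK w.
  move=> vN wN; apply: (@le_trans _ _ (pp (g v w))).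
    by rewrite -[leRHS]mul1r ler_wpM2r // /E; case: (e v w).
  have [gv gw] := g_le v w; have := x_ge0 v; have := x_ge0 w => xw xv.
  have IK0 : 0 <= IK v * IK w by rewrite mulr_ge0 ?ler0n.
  rewrite /IA; case vA: (v \in hubs); case wA: (w \in hubs); rewrite /= ?mul1r ?mul0r ?addr0 ?add0r.
  - by move: gv gw IK0; lra.
  - by move: gv gw IK0; lra.
  - by move: gv gw IK0; lra.
  have xvA := x_notA (negbT vA); have xwA := x_notA (negbT wA).
  apply: pp_le => //.
  have [hv|hv] := leP (e1 / 4) (x v); have [hw|hw] := leP (e1 / 4) (x w); last first.
  - by rewrite /g; move: xwA hv e1_gt0 IK0; lra.
  - by rewrite /g; move: xwA hv e1_gt0 IK0; lra.
  - by rewrite /g; move: xvA hw e1_gt0 IK0; lra.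
  rewrite !inE in vN wN; rewrite /IK !inE vN wN hv hw /= mul1r /g.
  by move: (x_le1 v) (x_le1 w); lra.
have sIA : \sum_(v in N) IA v = #|hubs :&: N|%:R.
  rewrite -sum1_card natr_sum [LHS]big_mkcond [RHS]big_mkcond; apply: eq_bigr => v _.
  by rewrite in_setI /IA; case: (v \in N); case: (v \in hubs).
have sIK : \sum_(v in N) IK v = #|heavyN|%:R.
  rewrite -sum1_card natr_sum [LHS]big_mkcond [RHS]big_mkcond; apply: eq_bigr => v _.
  by rewrite /IK /heavyN !inE; case: (e u v); case: (_ <= _).
have : \sum_(v in N) \sum_(w in N) E v w * pp (g v w) <=
    \sum_(v in N) \sum_(w in N) (IA v * x w + IA w * x v + IK v * IK w).
  by apply: ler_sum => v vN; apply: ler_sum => w wN; apply: b.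
under [X in _ <= X -> _]eq_bigr => v _ do
  rewrite !big_split /= -!mulr_sumr -mulr_suml -lam_sum_nbrs sIA sIK.
rewrite !big_split /= -!mulr_suml -mulr_sumr -lam_sum_nbrs sIA sIK => h1.
have h2 : #|heavyN|%:R * #|heavyN|%:R <= kapN ^+ 2 by rewrite expr2 ler_pM ?ler0n ?card_heavy_nbrs.
have h3 : 0 <= kapN ^+ 2 by apply: sqr_ge0.
by rewrite /gain; move: h1 h2 h3; lra.
Qed.

Let hub_nbrs_lt : (#|hubs :&: N| < #|hubs|)%N.
Proof.
apply: proper_card; rewrite properE subsetIl /=; apply/subsetPn; exists u => //.
by rewrite !inE irr_e andbF.
Qed.

(** The gain needs [k - 1] hubs inside [N]; the hub [u] lies outside [N], and there are at most [k]
    hubs in all. *)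
Lemma card_hubs : #|hubs :&: N| = k.-1 /\ #|hubs| = k.
Proof.
suff : (k <= #|hubs :&: N|.+1)%N.
  by have := card_hubs_le; have := hub_nbrs_lt; move: #|hubs| #|_| => i j; clear; lia.
rewrite leqNgt; apply/negP => lt.
have : #|hubs :&: N|%:R + 2 <= k%:R :> R by rewrite -natrD ler_nat addn2.
rewrite -(ler_pM2r lam_gt0) => h1.
by have := loss_le_gain; have := gain_le_hubs; move: h1 loss_ge0 lam_C5; rewrite /C5; lra.
Qed.

(** With the exact number of hubs, the terms in [lam] cancel, and the bound on [loss] improves from
    [O(lam)] to a constant. *)
Lemma loss_bounded : loss <= C5.
Proof.
have [cAN _] := card_hubs; have := loss_le_gain; have := gain_le_hubs; rewrite cAN.
have -> : k.-1%:R = k%:R - 1 :> R by rewrite -subn1 natrB.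
by rewrite /C5; lra.
Qed.

Theorem hub_structure : exists B : {set T},
  [/\ #|B| = k, {in B, forall a, 1 - e1 <= x a} & forall y, y \notin B -> x y <= 4 * H * eps].
Proof.
have [_ cA] := card_hubs; exists hubs; split=> // [a aA|y yA].
  rewrite -(ler_pM2l lam_gt0); move: aA; rewrite inE mulrC => /le_trans; apply.
  rewrite eigW; have : 0 <= \sum_(w in W) E a w * x w by apply: sumr_ge0 => w _; rewrite mulr_ge0.
  by have := E_ge0 a u; lra.
have xy := x_notA yA.
have yu : y != u by apply: contraNneq yA => ->.
(* A bounded number of neighbours in [N] bounds the link weight, hence the entry. *)
suff dNy : dN y <= r5 + kapN.
  rewrite -(ler_pM2l lam_gt0); have := entry_le_link_weight y; have := aN_le_dN y.
  by move: dNy lam_r5; lra.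
have r5' t : t * (e1 / 2) <= 2 * C5 -> t <= r5.
  by move=> ht; rewrite -(ler_pM2r e1_gt0); move: ht r5_ge; lra.
have kapN0 : 0 <= kapN by apply: le_trans card_heavy_nbrs; rewrite ler0n.
have [uy|uy] := boolP (e u y); last first.
  suff : dN y <= r5 by move: kapN0; lra.
  apply: r5'; apply: (@le_trans _ _ (dN y * (1 - x y))).
    by apply: ler_wpM2l => //; move: xy e1_gt0; lra.
  apply: (@le_trans _ _ (\sum_(w in W) dN w * (1 - x w))).
    rewrite (bigD1 y) /= ?inE ?yu // lerDl sumr_ge0 // => w _.
    by rewrite mulr_ge0 // subr_ge0.
  by have := loss_bounded; have := loss_ge0; rewrite /loss; move: slack_ge0 DWW_ge0; lra.
rewrite /dN (big_setID heavyN) /= addrC lerD //; last first.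
  apply: le_trans card_heavy_nbrs; rewrite -sum1_card natr_sum.
  have -> : N :&: heavyN = heavyN by apply/setIidPr/subsetP => v; rewrite inE => /andP[].
  by apply: ler_sum => v _; rewrite /E; case: (e y v).
(* An edge from [y], not a hub, to a light vertex of [N] has [- g] at least [e1 / 2], so [slack]
   limits the number of such edges. *)
apply: r5'; apply: (@le_trans _ _ (\sum_(v in N) E y v * pp (- g y v))).
  rewrite mulr_suml [leRHS](big_setID heavyN) /= -[leLHS]add0r lerD //.
    by apply: sumr_ge0 => v _; rewrite mulr_ge0.
  apply: ler_sum => v; rewrite !inE => /andP[nv vN]; rewrite vN /= -ltNge in nv.
  apply: ler_wpM2l => //; apply: le_trans (pp_ge _).
  by rewrite /g; move: nv xy e1_gt0; lra.
apply: (@le_trans _ _ (2 * slack)).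
  rewrite /slack mulrA divff ?pnatr_eq0 // mul1r [leRHS](bigD1 y) /= ?inE // lerDl.
  by apply: sumr_ge0 => v _; apply: sumr_ge0 => w _; rewrite mulr_ge0.
by have := loss_bounded; rewrite /loss; move: DW_ge0 DWW_ge0; lra.
Qed.
End Core.

(** * Rigidity around the hubs *)

Section HubCounts.
Variables (T : finType) (e : rel T) (A : {set T}).

Definition hub_degree v : nat := #|[set a in A | e v a]|.
Definition full_vertices := [set v in ~: A | hub_degree v == #|A|].
Definition partial_vertices := [set v in ~: A | hub_degree v != #|A|].
(* [hub_defect] and [outer_edges] count ordered pairs. *)
Definition hub_defect : nat := (\sum_(a in A) \sum_(b in A) ((a != b) && ~~ e a b))%N.
Definition outer_edges : nat := (\sum_(v in ~: A) \sum_(w in ~: A) e v w)%N.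

Lemma hub_degreeE v : hub_degree v = (\sum_(a in A) e v a)%N.
Proof.
rewrite /hub_degree -sum1_card [RHS]big_mkcond [LHS]big_mkcond; apply: eq_bigr => a _.
by rewrite inE; case: (a \in A); case: (e v a).
Qed.

Lemma hub_degree_le v : (hub_degree v <= #|A|)%N.
Proof. by apply: subset_leq_card; apply/subsetP => a; rewrite inE => /andP[]. Qed.

Lemma sum_split_outer (R : zmodType) (F : T -> R) :
  \sum_(v in ~: A) F v = \sum_(v in full_vertices) F v + \sum_(v in partial_vertices) F v.
Proof.
rewrite (bigID (fun v => hub_degree v == #|A|)) /=; congr (_ + _).
all: by apply: eq_bigl => v; rewrite !inE.
Qed.

Hypotheses (sym_e : symmetric e) (irr_e : irreflexive e).

(** Ordered adjacent pairs are sorted by membership in [A]; [hub_defect] completes the pairs inside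
    [A] to those of a clique. *)
Lemma hub_count : (\sum_v \sum_w e v w + hub_defect =
  #|A| * (#|A| - 1) + 2 * (#|A| * #|full_vertices| + \sum_(v in partial_vertices) hub_degree v)
    + outer_edges)%N.
Proof.
have spl (F : T -> nat) : (\sum_v F v = \sum_(v in A) F v + \sum_(v in ~: A) F v)%N.
  by rewrite (bigID (mem A)) /=; congr addn; apply: eq_bigl => v; rewrite ?inE.
have BA : (\sum_(v in ~: A) \sum_(a in A) e v a =
    #|A| * #|full_vertices| + \sum_(v in partial_vertices) hub_degree v)%N.
  under eq_bigr => v _ do rewrite -hub_degreeE.
  rewrite (bigID (fun v => hub_degree v == #|A|)) /=; congr addn; last first.
    by apply: eq_bigl => v; rewrite !inE.
  rewrite mulnC -sum_nat_const; apply: congr_big => //; first by move=> v; rewrite !inE.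
  by move=> v /andP[_ /eqP].
have AB : (\sum_(a in A) \sum_(v in ~: A) e a v = \sum_(v in ~: A) \sum_(a in A) e v a)%N.
  by rewrite exchange_big; apply: eq_bigr => v _; apply: eq_bigr => a _; rewrite sym_e.
have AA : (\sum_(a in A) \sum_(b in A) e a b + hub_defect = #|A| * (#|A| - 1))%N.
  rewrite /hub_defect -big_split /= -sum_nat_const; apply: eq_bigr => a aA.
  rewrite -big_split /= (bigD1 a) //= irr_e eqxx /= add0n.
  rewrite (eq_bigr (fun=> 1%N)) => [|b /andP[_ ba]].
    have := cardsD1 a A; rewrite aA -sum1_card => ->; rewrite addKn -sum1_card.
    by apply: eq_bigl => b; rewrite !inE andbC.
  by rewrite eq_sym ba; case: (e a b).
rewrite spl.
under eq_bigr => v _ do rewrite spl.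
under [X in (_ + X + _)%N]eq_bigr => v _ do rewrite spl.
by rewrite !big_split /= AB BA -AA -/outer_edges mul2n -addnn; lia.
Qed.

Lemma hub_defect_le : (hub_defect <= #|A| * #|A|)%N.
Proof.
rewrite /hub_defect -{1}sum1_card big_distrl /=; apply: leq_sum => a _.
by rewrite mul1n -sum1_card; apply: leq_sum => b _; case: (_ && _).
Qed.

Variables (R : realFieldType) (x : T -> R) (lam dl eps : R) (t s : nat) (Xs : R).
Hypotheses (x_ge0 : forall v, 0 <= x v) (x_le1 : forall v, x v <= 1).
Hypothesis eig : forall v, \sum_w (e v w)%:R * x w = lam * x v.
Hypotheses (A_gt0 : (0 < #|A|)%N) (xA : {in A, forall a, 1 - dl <= x a})
  (xB : forall v, v \notin A -> x v <= eps).
Hypothesis m_eq : (\sum_v \sum_w e v w = #|A| * (#|A| - 1) + 2 * (#|A| * t + s))%N.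
Hypotheses (sA : (s < #|A|)%N) (Xs_ge : s%:R * (1 - dl) <= Xs).
Hypothesis ray : let X := \sum_(a in A) x a in let X2 := \sum_(a in A) x a ^+ 2 in
  X ^+ 2 - X2 + (t%:R * X ^+ 2 + Xs ^+ 2) / lam <= lam * X2.
Hypotheses (dl_ge0 : 0 <= dl) (eps_ge0 : 0 <= eps).
Hypotheses (dl_small : 16 * #|A|%:R ^+ 2 * dl <= 1) (eps_small : 16 * #|A|%:R * eps <= 1).
Hypothesis lam_large : 4 * #|A|%:R ^+ 2 * (#|A|%:R + 1) < lam.

Let E v w : R := (e v w)%:R.
Let E_ge0 v w : 0 <= E v w. Proof. exact: ler0n. Qed.

(** The hypothesis [ray] tests the split graph on the hub entries of [x]. Comparison with the
    eigenvalue equation of [e] gives the inequality required by [rigid_arithmetic]. *)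
Lemma hub_rigid : [/\ hub_defect = 0, outer_edges = 0, #|full_vertices| = t,
  \sum_(v in partial_vertices) hub_degree v = s
  & \sum_(v in partial_vertices) hub_degree v ^ 2 = s ^ 2]%N.
Proof.
pose X := \sum_(a in A) x a; pose X2 := \sum_(a in A) x a ^+ 2.
pose sg v := \sum_(a in A) E v a * x a; pose rr v := \sum_(w in ~: A) E v w * x w.
pose M := \sum_(a in A) \sum_(b in A) ((a != b) && ~~ e a b)%:R * (x a * x b).
have k1 : 1 <= #|A|%:R :> R by rewrite ler1n.
have dl1 : dl <= 1 / 16.
  have : 16 * 1 * dl <= 16 * #|A|%:R ^+ 2 * dl.
    by rewrite ler_wpM2r // ler_pM2l ?ltr0n // expr2 -[leLHS]mulr1 ler_pM.
  by move: dl_small; lra.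
have lam0 : 0 < lam.
  by apply: le_lt_trans lam_large; rewrite !mulr_ge0 ?addr_ge0 ?sqr_ge0 ?ler0n.
have splR (F : T -> R) : \sum_v F v = \sum_(v in A) F v + \sum_(v in ~: A) F v.
  by rewrite (bigID (mem A)) /=; congr (_ + _); apply: eq_bigl => v; rewrite ?inE.
have id1 : lam * X2 = \sum_(a in A) \sum_(b in A) E a b * (x a * x b) + \sum_(v in ~: A) sg v * x v.
  rewrite /X2 mulr_sumr.
  have -> : \sum_(v in ~: A) sg v * x v = \sum_(a in A) \sum_(v in ~: A) E a v * (x a * x v).
    rewrite exchange_big; apply: eq_bigr => v _; rewrite mulr_suml; apply: eq_bigr => a _.
    by rewrite /E sym_e; ring.
  rewrite -big_split /=; apply: eq_bigr => a _.
  rewrite expr2 mulrA -eig splR mulrDl !mulr_suml; congr (_ + _);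
    by apply: eq_bigr => b _; rewrite /E; ring.
have id2 : X ^+ 2 - X2 = \sum_(a in A) \sum_(b in A) E a b * (x a * x b) + M.
  rewrite /M -big_split /= /X2 expr2 {1}/X mulr_suml -sumrB; apply: eq_bigr => a aA.
  rewrite -big_split /= mulr_sumr (bigD1 a) //= [RHS](bigD1 a) //= /E irr_e eqxx.
  rewrite /= !mul0r !add0r expr2 addrAC subrr add0r; apply: eq_bigr => b /andP[_ ba].
  by rewrite eq_sym ba; case: (e a b); rewrite /= ?mul1r ?mul0r ?addr0 ?add0r.
have id3 : lam * \sum_(v in ~: A) sg v * x v = \sum_(v in ~: A) sg v ^+ 2 + \sum_(v in ~: A) sg v * rr v.
  rewrite mulr_sumr -big_split; apply: eq_bigr => v _ /=.
  by rewrite mulrCA -eig splR -/(sg v) -/(rr v); ring.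
(* The edges inside [A] cancel between [id1] and [id2], leaving the missing pairs [M]; multiplying
   by [lam] allows the outer entries to be expanded by [id3]. *)
have main : lam * M + (t%:R * X ^+ 2 + Xs ^+ 2) <=
    \sum_(v in ~: A) sg v ^+ 2 + \sum_(v in ~: A) sg v * rr v.
  have : X ^+ 2 - X2 + (t%:R * X ^+ 2 + Xs ^+ 2) / lam <= lam * X2 := ray.
  rewrite -id3 id2 id1 => h.
  have : lam * (M + (t%:R * X ^+ 2 + Xs ^+ 2) / lam) <= lam * \sum_(v in ~: A) sg v * x v.
    by rewrite ler_pM2l //; move: h; lra.
  by rewrite mulrDr [lam * (_ / _)]mulrCA divff ?mulr1 // gt_eqF.
have Mge : hub_defect%:R * (1 - dl) ^+ 2 <= M.
  rewrite /hub_defect natr_sum mulr_suml; apply: ler_sum => a aA.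
  rewrite natr_sum mulr_suml; apply: ler_sum => b bA.
  rewrite ler_wpM2l ?ler0n // expr2 ler_pM ?xA //; move: dl1; lra.
have sg_le v : sg v <= (hub_degree v)%:R.
  rewrite hub_degreeE natr_sum; apply: ler_sum => a _.
  by rewrite -[leRHS]mulr1 ler_wpM2l.
have sg_ge0 v : 0 <= sg v by apply: sumr_ge0 => a _; rewrite mulr_ge0.
have sgF v : v \in full_vertices -> sg v = X.
  rewrite !inE => /andP[_ /eqP dv]; apply: eq_bigr => a aA.
  have /eqP : [set a in A | e v a] == A.
    by rewrite eqEcard -[X in (_ <= X)%N]/(hub_degree v) dv leqnn andbT; apply/subsetP => b; rewrite inE => /andP[].
  by move/setP/(_ a); rewrite inE aA /= /E => ->; rewrite mul1r.
have s2 : \sum_(v in ~: A) sg v ^+ 2 <=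
    #|full_vertices|%:R * X ^+ 2 + (\sum_(v in partial_vertices) hub_degree v ^ 2)%N%:R.
  rewrite sum_split_outer lerD //.
    rewrite (eq_bigr (fun=> X ^+ 2)) => [|v /sgF -> //].
    by rewrite sumr_const mulr_natl.
  rewrite natr_sum; apply: ler_sum => v _; rewrite natrX lerXn2r ?nnegrE ?ler0n //.
(* [sg v] is at most the number of hubs, and [rr v] at most [eps] times the number of neighbours of
   [v] outside [A]. *)
have s3 : \sum_(v in ~: A) sg v * rr v <= #|A|%:R * eps * outer_edges%:R.
  rewrite /outer_edges natr_sum mulr_sumr; apply: ler_sum => v _.
  rewrite natr_sum -mulrA; apply: ler_pM => //.
  - by apply: sumr_ge0 => w _; rewrite mulr_ge0.
  - by apply: le_trans (sg_le v) _; rewrite ler_nat hub_degree_le.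
  rewrite mulr_sumr; apply: ler_sum => w; rewrite inE => wA.
  by rewrite mulrC ler_wpM2r // xB.
have Xl : #|A|%:R * (1 - dl) <= X.
  by rewrite mulr_natl -sumr_const; apply: ler_sum.
have Xu : X <= #|A|%:R by rewrite -sumr_const; apply: ler_sum.
apply: (@rigid_arithmetic R #|A| t s _ _ _ _ _ lam X Xs dl eps) => //.
- have := hub_count; rewrite m_eq; clear; lia.
- exact: hub_defect_le.
- apply: sum_squares_le_packed => // v; rewrite !inE => /andP[_ ne].
  by rewrite ltn_neqAle ne hub_degree_le.
- rewrite big_distrr /=; apply: leq_sum => v; rewrite !inE => /andP[_ ne].
  rewrite expnS expn1 leq_mul2r; apply/orP; right.
  by have := hub_degree_le v; clear - ne; lia.
have : lam * (hub_defect%:R * (1 - dl) ^+ 2) <= lam * M by rewrite ler_wpM2l // ltW.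
by move: main s2 s3; lra.
Qed.

End HubCounts.

Local Close Scope ring_scope.

(** * Reconstruction of the split graph from the counts *)

Section HubIso.
Variables (n : nat) (e : rel 'I_n) (k m : nat) (A : {set 'I_n}).
Hypotheses (sym_e : symmetric e) (irr_e : irreflexive e).
Hypotheses (k_gt0 : 0 < k) (cA : #|A| = k) (t_gt0 : 0 < split_t k m).
Hypotheses (defect0 : hub_defect e A = 0) (outer0 : outer_edges e A = 0).
Hypothesis cF : #|full_vertices e A| = split_t k m.
Hypothesis sumP : \sum_(v in partial_vertices e A) hub_degree e A v = split_s k m.
Hypothesis sumP2 : \sum_(v in partial_vertices e A) hub_degree e A v ^ 2 = split_s k m ^ 2.

Let t := split_t k m.
Let s := split_s k m.
Let d := hub_degree e A.
Let F := full_vertices e A.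
Let Rp := [set v in partial_vertices e A | 0 < d v].
Let S0 := [set a in A | [exists v in Rp, e v a]].

Let sk : s < k. Proof. by rewrite ltn_mod. Qed.

Let eAA a b : a \in A -> b \in A -> e a b = (a != b).
Proof.
move=> aA bA; have [->|ab] := eqVneq a b; first by rewrite irr_e.
move/eqP: defect0; rewrite sum_nat_eq0 => /forall_inP/(_ a aA).
by rewrite sum_nat_eq0 => /forall_inP/(_ b bA); rewrite ab; case: (e a b).
Qed.

Let eBB v w : v \notin A -> w \notin A -> e v w = false.
Proof.
move=> vA wA; move/eqP: outer0; rewrite sum_nat_eq0 => /forall_inP/(_ v).
by rewrite inE => /(_ vA); rewrite sum_nat_eq0 => /forall_inP/(_ w); rewrite inE => /(_ wA); case: (e v w).
Qed.

Let eFA v a : v \in F -> a \in A -> e v a.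
Proof.
rewrite inE => /andP[_ /eqP dv] aA.
have /eqP/setP/(_ a) : [set b in A | e v b] == A.
  by rewrite eqEcard -[X in _ <= X]/(d v) /d dv leqnn andbT; apply/subsetP => b; rewrite inE => /andP[].
by rewrite inE aA.
Qed.

Let d_le v : v \in partial_vertices e A -> d v <= s.
Proof. by move=> vP; rewrite /s -sumP (bigD1 v) //= leq_addr. Qed.

Let d_cases v : v \in Rp -> d v = s.
Proof.
rewrite inE => /andP[vP dv].
(* The hub degrees sum to [s] and their squares to [s ^ 2]. Each is at most [s], so every positive
   one equals [s], and only one can occur. *)
have : \sum_(v in partial_vertices e A) d v * (s - d v) == 0.
  rewrite -(eqn_add2r (\sum_(v in partial_vertices e A) d v ^ 2)) add0n -big_split /= sumP2.
  rewrite (eq_bigr (fun v => d v * s)) => [|w /d_le dw].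
    by rewrite -big_distrl /= sumP mulnn.
  by rewrite -mulnn -mulnDr subnK.
rewrite sum_nat_eq0 => /forall_inP/(_ v vP); have := d_le vP; move: dv.
by rewrite muln_eq0; clear; lia.
Qed.

Let Rp_uniq v w : v \in Rp -> w \in Rp -> v = w.
Proof.
move=> vR wR; apply/eqP; apply: contraT => vw.
have dv := d_cases vR; have dw := d_cases wR.
move: vR wR; rewrite !inE => /andP[/andP[vA vP] dv0] /andP[/andP[wA wP] dw0].
have := sumP; rewrite (bigD1 v) /= ?inE ?vA // (bigD1 w) /=; last by rewrite !inE wA wP eq_sym.
by rewrite -/(d v) -/(d w) -/s; move: dv dw dv0; clear; lia.
Qed.

Let RpA v : v \in Rp -> v \notin A.
Proof. by rewrite !inE => /andP[/andP[]]. Qed.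

Let FA v : v \in F -> v \notin A.
Proof. by rewrite !inE => /andP[]. Qed.

Let RpF v : v \in Rp -> v \notin F.
Proof. by rewrite !inE => /andP[/andP[-> /negPf ->]]. Qed.

Let eRA v a : v \in Rp -> a \in A -> e v a = (a \in S0).
Proof.
move=> vR aA; rewrite inE aA; apply/idP/exists_inP => [va|[w wR wa]]; first by exists v.
by rewrite (Rp_uniq vR wR).
Qed.

Let cS0 : #|S0| = s.
Proof.
have [R0|[v vR]] := set_0Vmem Rp.
  have -> : s = 0.
    rewrite /s -sumP big1 // => v vP; apply/eqP; rewrite -leqn0 leqNgt; apply/negP => dv.
    by have : v \in Rp by [rewrite inE vP]; rewrite R0 inE.
  apply/eqP; rewrite cards_eq0 -subset0; apply/subsetP => a; rewrite inE => /andP[_ /exists_inP[v]].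
  by rewrite R0 inE.
rewrite -(d_cases vR); apply: eq_card => a; rewrite [RHS]inE.
by case aA: (a \in A); [rewrite (eRA vR) | rewrite inE aA].
Qed.

(** The hubs adjacent to the extra vertex are listed first, because [split_graph] joins its extra
    vertex to the labels below [s]. *)
Let L := enum S0 ++ enum (A :\: S0).

Let S0A : S0 \subset A. Proof. by apply/subsetP => a; rewrite inE => /andP[]. Qed.

Let mem_L a : (a \in L) = (a \in A).
Proof.
rewrite mem_cat !mem_enum in_setD; case aS: (a \in S0) => //=.
by rewrite (subsetP S0A).
Qed.

Let size_L : size L = k.
Proof. by rewrite size_cat -!cardE cardsD (setIidPr S0A) subnKC ?subset_leq_card. Qed.

Let index_L a : a \in A -> (index a L < s) = (a \in S0).
Proof.
move=> aA; rewrite index_cat mem_enum; case aS: (a \in S0).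
  by rewrite -cS0 cardE index_mem mem_enum.
by rewrite -cardE cS0 ltnNge leq_addr.
Qed.

(** Isolated vertices share the label [k + t] with the extra vertex; injectivity is claimed on
    nonisolated vertices only. *)
Let fn v := if v \in A then index v L else if v \in F then k + index v (enum F) else k + t.

Let fnA v : v \in A -> fn v < k.
Proof. by move=> vA; rewrite /fn vA -[X in _ < X]size_L index_mem mem_L. Qed.

Let fnF v : v \in F -> k <= fn v < k + t.
Proof.
move=> vF; rewrite /fn (negPf (FA vF)) vF leq_addr ltn_add2l.
by rewrite /t -cF cardE index_mem mem_enum.
Qed.

Let fnR v : v \in Rp -> fn v = k + t.
Proof. by move=> vR; rewrite /fn (negPf (RpA vR)) (negPf (RpF vR)). Qed.

Let fn_lt v : fn v < k + t + 1.
Proof.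
have [vA|vA] := boolP (v \in A); first by have := fnA vA; clear; lia.
have [vF|vF] := boolP (v \in F); first by have := fnF vF; clear; lia.
by rewrite /fn (negPf vA) (negPf vF) addn1.
Qed.

Let f v : 'I_(k + t + 1) := Ordinal (fn_lt v).

Let noniso_cases v : nonisolated e v -> [\/ v \in A, v \in F | v \in Rp].
Proof.
case/existsP => w vw; have [vA|vA] := boolP (v \in A); first by constructor 1.
have wA : w \in A by apply: contraT => wA; rewrite eBB in vw.
have dv : 0 < d v by apply/card_gt0P; exists w; rewrite inE wA.
have [vF|vF] := boolP (v \in F); first by constructor 2.
constructor 3; rewrite inE dv andbT inE in_setC vA /=.
by apply: contra vF => h; rewrite inE in_setC vA h.
Qed.

Let fn_inj v w : nonisolated e v -> nonisolated e w -> fn v = fn w -> v = w.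
Proof.
case/noniso_cases => hv; case/noniso_cases => hw.
- by rewrite /fn hv hw => h; apply: (index_inj v _ _ h); rewrite mem_L.
- by have := fnA hv; have := fnF hw; clear; lia.
- by rewrite (fnR hw); have := fnA hv; clear; lia.
- by have := fnA hw; have := fnF hv; clear; lia.
- rewrite /fn (negPf (FA hv)) (negPf (FA hw)) hv hw => /addnI h.
  by apply: (index_inj v _ _ h); rewrite mem_enum.
- by rewrite (fnR hw); have := fnF hv; clear; lia.
- by rewrite (fnR hv); have := fnA hw; clear; lia.
- by rewrite (fnR hv); have := fnF hw; clear; lia.
- by move=> _; apply: Rp_uniq.
Qed.

Let splitE (i j : 'I_(k + t + 1)) : split_graph k m i j = (val i != val j) &&
  ([|| (i < k) && (j < k), (i < k) && (k <= j < k + t) | (j == k + t :> nat) && (i < s)] ||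
   [|| (j < k) && (i < k), (j < k) && (k <= i < k + t) | (i == k + t :> nat) && (j < s)]).
Proof. by []. Qed.

Let f_edge v w : nonisolated e v -> nonisolated e w -> e v w = split_graph k m (f v) (f w).
Proof.
move=> nv nw; rewrite splitE /=.
case: (noniso_cases nv) => hv; case: (noniso_cases nw) => hw.
- rewrite eAA // (fnA hv) (fnA hw) /= andbT; congr (~~ _).
  by apply/eqP/eqP => [->|/fn_inj] //; apply.
- by rewrite sym_e eFA //; have := fnA hv; have := fnF hw; clear; lia.
- rewrite sym_e eRA // -index_L // (fnR hw); have : fn v = index v L by rewrite /fn hv.
  by have := fnA hv; move=> h <-; move: h sk; clear; lia.
- by rewrite eFA //; have := fnA hw; have := fnF hv; clear; lia.
- by rewrite (eBB (FA hv) (FA hw)); have := fnF hv; have := fnF hw; clear; lia.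
- by rewrite (eBB (FA hv) (RpA hw)) (fnR hw); have := fnF hv; move: sk; clear; lia.
- rewrite eRA // -index_L // (fnR hv); have : fn w = index w L by rewrite /fn hw.
  by have := fnA hw; move=> h <-; move: h sk; clear; lia.
- by rewrite (eBB (RpA hv) (FA hw)) (fnR hv); have := fnF hw; move: sk; clear; lia.
- by rewrite (eBB (RpA hv) (RpA hw)) (fnR hv) (fnR hw) eqxx.
Qed.

Lemma hub_iso : iso_up_to_isolated e (split_graph k m).
Proof.
have /card_gt0P[v0 v0F] : 0 < #|F| by rewrite cF.
have nA a : a \in A -> nonisolated e a.
  by move=> aA; apply/existsP; exists v0; rewrite sym_e eFA.
have nF v : v \in F -> nonisolated e v.
  have /card_gt0P[a aA] : 0 < #|A| by rewrite cA.
  by move=> vF; apply/existsP; exists a; rewrite eFA.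
have nR v : v \in Rp -> nonisolated e v.
  rewrite inE => /andP[_ /card_gt0P[a]]; rewrite inE => /andP[_ va].
  by apply/existsP; exists a.
exists f; split.
- by move=> v w nv nw /(congr1 val) /=; apply: fn_inj.
- move=> v nv; case/existsP: (nv) => w vw; apply/existsP; exists (f w).
  by rewrite -f_edge //; apply/existsP; exists v; rewrite sym_e.
- move=> i ni; have [ik|ki] := ltnP i k.
    have iL : i < size L by rewrite size_L.
    have aA : nth v0 L i \in A by rewrite -mem_L mem_nth.
    exists (nth v0 L i); first exact: nA.
    apply: val_inj => /=; rewrite /fn aA index_uniq // cat_uniq !enum_uniq andbT /=.
    by apply/hasPn => a; rewrite !mem_enum inE => /andP[].
  have [ikt|kti] := ltnP i (k + t).
    have iF : i - k < size (enum F) by rewrite -cardE cF ltn_subLR.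
    have vF : nth v0 (enum F) (i - k) \in F by rewrite -mem_enum mem_nth.
    exists (nth v0 (enum F) (i - k)); first exact: nF.
    apply: val_inj => /=; rewrite /fn (negPf (FA vF)) vF index_uniq ?enum_uniq //.
    by move: ki; clear; lia.
  have iE : val i = k + t.
    by apply/eqP; rewrite eqn_leq kti andbT -ltnS -[(k + t).+1]addn1 ltn_ord.
  have s0 : 0 < s.
    case/existsP: ni => j; rewrite splitE -[val i]/(nat_of_ord i) iE /=.
    by move: sk (ltn_ord j); clear; lia.
  have /card_gt0P[a] : 0 < #|S0| by rewrite cS0.
  rewrite inE => /andP[_ /exists_inP[v vR _]]; exists v; first exact: nR.
  by apply: val_inj; rewrite /= fnR.
- by move=> v w nv nw; apply: f_edge.
Qed.

End HubIso.

(** * Choice of the constants and conclusion *)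

Local Open Scope ring_scope.

(** All the constants are fixed in terms of [h], [k] and [c] before the graph is given, so a single
    threshold [L] on [lam] serves every graph. *)
Lemma hub_structure_large (R : realFieldType) (h k c : nat) : (0 < k)%N ->
  exists L : nat, forall (T : finType) (e : rel T) (x : T -> R) (lam : R) (u : T),
    symmetric e -> irreflexive e -> (forall v, 0 <= x v) -> (forall v, x v <= 1) -> x u = 1 ->
    (forall v, \sum_w (e v w)%:R * x w = lam * x v) ->
    degenerate_links e h -> thin_bicliques e h k ->
    2^-1 * \sum_v \sum_w (e v w)%:R + (k%:R - 1) * lam - c%:R <= lam ^+ 2 ->
    L%:R <= lam ->
  exists (B : {set T}) (dl eps : R),
    [/\ #|B| = k, {in B, forall a, 1 - dl <= x a} & forall y, y \notin B -> x y <= eps] /\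
    [/\ 0 <= dl, 0 <= eps, 16 * k%:R ^+ 2 * dl <= 1, 16 * k%:R * eps <= 1
      & 4 * k%:R ^+ 2 * (k%:R + 1) < lam].
Proof.
move=> k0.
(* [N1] and [N2] are the inverses of [e1] and [eps]. [Kap], [KapN] and [R5] then satisfy their
   defining inequalities with equality. *)
pose N1 := (16 * h.+1 * k.+1 ^ 2)%N; pose N2 := (64 * h.+1 * N1 * k)%N.
pose Kap := (4 * h.+1 * N1 * N2)%N; pose KapN := (32 * h * N1)%N.
pose C5 := (c + KapN ^ 2)%N; pose R5 := (4 * C5 * N1)%N.
exists (1 + 4 * c + 2 * h + N2 * (1 + k + Kap) + 32 * h * N1 + C5 + N2 * (R5 + KapN)
        + 4 * k ^ 2 * (k + 1))%N.
move=> T e x lam u sym_e irr_e x0 x1 xu eig deg thin lam2 lamL.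
pose n1 : R := N1%:R; pose n2 : R := N2%:R.
pose hh : R := h%:R + 1.
have hh1 : 1 <= hh by rewrite /hh lerDr ler0n.
have hhE : h.+1%:R = hh by rewrite -natr1.
have kkE : k.+1%:R = k%:R + 1 :> R by rewrite natr1.
have kr1 : 1 <= k%:R :> R by rewrite ler1n.
have n1E : n1 = 16 * hh * (k%:R + 1) ^+ 2 by rewrite /n1 /N1 2!natrM natrX hhE kkE.
have n2E : n2 = 64 * hh * n1 * k%:R by rewrite /n2 /N2 3!natrM hhE.
have n1_gt0 : 0 < n1 by rewrite ltr0n !muln_gt0.
have n2_gt0 : 0 < n2 by rewrite ltr0n !muln_gt0 k0.
have n1_ge1 : 1 <= n1 by rewrite ler1n !muln_gt0.
have n2_ge1 : 1 <= n2 by rewrite ler1n !muln_gt0 k0.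
have nz1 : n1 != 0 by rewrite gt_eqF.
have nz2 : n2 != 0 by rewrite gt_eqF.
pose e1 := n1^-1; pose eps := n2^-1.
have e1n : e1 * n1 = 1 by rewrite mulVf.
have e2n : eps * n2 = 1 by rewrite mulVf.
have lamge : [/\ 1 <= lam, 4 * c%:R <= lam, 2 * h%:R <= lam, n2 * (1 + k%:R + Kap%:R) <= lam
   & [/\ 32 * h%:R * n1 <= lam, (c%:R + KapN%:R ^+ 2) < lam, n2 * (R5%:R + KapN%:R) <= lam
   & 4 * k%:R ^+ 2 * (k%:R + 1) < lam]].
  have bound (P : nat) (r : R) : P%:R = r ->
      (P <= 1 + 4 * c + 2 * h + N2 * (1 + k + Kap) + 32 * h * N1 + C5 + N2 * (R5 + KapN)
        + 4 * k ^ 2 * (k + 1))%N -> r <= lam.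
    by move=> <- le; apply: le_trans lamL; rewrite ler_nat.
  have bound_lt (P : nat) (r : R) : P%:R = r ->
      (P < 1 + 4 * c + 2 * h + N2 * (1 + k + Kap) + 32 * h * N1 + C5 + N2 * (R5 + KapN)
        + 4 * k ^ 2 * (k + 1))%N -> r < lam.
    by move=> <- le; apply: lt_le_trans lamL; rewrite ltr_nat.
  have C5E : C5%:R = c%:R + KapN%:R ^+ 2 :> R by rewrite natrD natrX.
  have E1 : (N2 * (1 + k + Kap))%:R = n2 * (1 + k%:R + Kap%:R) by rewrite natrM 2!natrD.
  have E2 : (N2 * (R5 + KapN))%:R = n2 * (R5%:R + KapN%:R) by rewrite natrM natrD.
  have E3 : (4 * k ^ 2 * (k + 1))%:R = 4 * k%:R ^+ 2 * (k%:R + 1) :> R by rewrite 2!natrM natrX natrD.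
  have E4 : (4 * c)%:R = 4 * c%:R :> R by rewrite natrM.
  have E5 : (2 * h)%:R = 2 * h%:R :> R by rewrite natrM.
  have E6 : (32 * h * N1)%:R = 32 * h%:R * n1 by rewrite 2!natrM.
  move: (N2 * (1 + k + Kap))%N (N2 * (R5 + KapN))%N (4 * k ^ 2 * (k + 1))%N
    (32 * h * N1)%N (C5) bound bound_lt C5E E1 E2 E3 E6 => a1 a2 a3 a4 a5 bound bound_lt E7 E1 E2 E3 E6.
  by split; [apply: (bound 1%N) => //|apply: (bound _ _ E4)|apply: (bound _ _ E5)
    |apply: (bound _ _ E1)|split; [apply: (bound _ _ E6)|apply: (bound_lt _ _ E7)
    |apply: (bound _ _ E2)|apply: (bound_lt _ _ E3)]]; clear; lia.
case: lamge => l1 l2 l3 l4 [l5 l6 l7 l8].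
have e1_gt0 : 0 < e1 by rewrite invr_gt0.
have eps_gt0 : 0 < eps by rewrite invr_gt0.
have hk_n1 : 16 * (hh * (k%:R + 1)) <= n1.
  rewrite n1E -!mulrA ler_pM2l ?ltr0n // ler_wpM2l //; first by lra.
  by rewrite expr2 -[leLHS]mulr1 ler_wpM2l //; lra.
have k2_n1 : 16 * k%:R ^+ 2 <= n1.
  rewrite n1E -mulrA ler_pM2l ?ltr0n // -[leLHS]mul1r ler_pM ?sqr_ge0 //.
  by rewrite lerXn2r ?nnegrE ?addr_ge0 ?ler0n //; lra.
have n1_n2 : 64 * hh * n1 <= n2.
  by rewrite n2E -[leLHS]mulr1 ler_wpM2l // !mulr_ge0 ?ler0n //; lra.
have kh_n2 : 64 * hh * k%:R <= n2.
  rewrite n2E -[leLHS]mulr1 [leRHS](_ : _ = 64 * hh * k%:R * n1); last by ring.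
  by rewrite ler_wpM2l // !mulr_ge0 ?ler0n //; lra.
have he_lam t : n2 * t <= lam -> 0 <= t -> t <= hh * eps * lam.
  move=> nt t0; apply: (@le_trans _ _ (eps * lam)).
    have : eps * (n2 * t) <= eps * lam by rewrite ler_wpM2l // ltW.
    by rewrite mulrA e2n mul1r.
  have el : 0 <= eps * lam by apply: mulr_ge0; [exact: ltW|lra].
  by rewrite -mulrA -[leLHS]mul1r ler_wpM2r.
have i1 : eps <= 1 / 2.
  rewrite -(ler_pM2r n2_gt0) e2n.
  have : 64 * 1 * 1 <= 64 * hh * n1 by rewrite !ler_pM ?mulr_ge0 ?ler0n.
  by lra.
have i2 : hh * (k%:R + 1) * e1 <= 1 / 8.
  by rewrite -(ler_pM2r n1_gt0) -[leLHS]mulrA e1n; lra.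
have i3 : 3 * hh * eps <= e1 / 8.
  rewrite -(ler_pM2r n2_gt0) -[leLHS]mulrA e2n mulr1.
  have : e1 * (64 * hh * n1) <= e1 * n2 by rewrite ler_wpM2l // ltW.
  have -> : e1 * (64 * hh * n1) = 64 * hh * (e1 * n1) by ring.
  by rewrite e1n; lra.
have i4 : 4 * hh <= Kap%:R * (eps * e1).
  have -> : Kap%:R * (eps * e1) = 4 * hh * (e1 * n1) * (eps * n2).
    by rewrite /Kap 3!natrM hhE -/n1 -/n2; ring.
  by rewrite e1n e2n !mulr1.
have i5 : 32 * h%:R <= KapN%:R * e1.
  have -> : KapN%:R * e1 = 32 * h%:R * (e1 * n1) by rewrite /KapN 2!natrM -/n1; ring.
  by rewrite e1n mulr1.
have i6 : 4 * (c%:R + KapN%:R ^+ 2) <= R5%:R * e1.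
  have -> : R5%:R * e1 = 4 * (c%:R + KapN%:R ^+ 2) * (e1 * n1).
    by rewrite /R5 2!natrM /C5 natrD natrX -/n1; ring.
  by rewrite e1n mulr1.
have i7 : 1 + k%:R + Kap%:R <= hh * eps * lam.
  by apply: he_lam => //; rewrite !addr_ge0 ?ler0n.
have i8 : 32 * h%:R <= e1 * lam.
  have : e1 * (32 * h%:R * n1) <= e1 * lam by rewrite ler_wpM2l // ltW.
  have -> : e1 * (32 * h%:R * n1) = 32 * h%:R * (e1 * n1) by ring.
  by rewrite e1n mulr1.
have i9 : R5%:R + KapN%:R <= hh * eps * lam.
  by apply: he_lam => //; rewrite !addr_ge0 ?ler0n.
have [B [cB xB xnB]] := @hub_structure R T e x lam u sym_e irr_e x0 x1 xu eig h k k0 deg thin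
  c%:R e1 eps lam2 (ler0n _ _) e1_gt0 eps_gt0 i1 i2 i3 l1 l2 l3 Kap%:R KapN%:R R5%:R
  i4 i5 i6 i7 i8 l6 i9.
exists B, e1, (4 * hh * eps); split=> //; split=> //.
- exact: ltW.
- by rewrite !mulr_ge0 ?ler0n // ltW // (lt_le_trans ltr01).
- by rewrite -(ler_pM2r n1_gt0) -[leLHS]mulrA e1n; lra.
have -> : 16 * k%:R * (4 * hh * eps) = 64 * hh * k%:R * eps by ring.
by rewrite -(ler_pM2r n2_gt0) -[leLHS]mulrA e2n; lra.
Qed.

Lemma sum_nth_enum (R : zmodType) (T : finType) (u : T) (B : {set T}) (F : T -> R) :
  \sum_(a in B) F a = \sum_(i < #|B|) F (nth u (enum B) i).
Proof. by rewrite -big_enum (big_nth u) big_mkord -cardE. Qed.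

(** Test vector with all clique entries equal to 1, the contribution of the extra vertex being
    dropped. *)
Lemma split_lambda_ge k m (l : algR) : (0 < k)%N -> 0 < l -> lambdaR (split_graph k m) <= l ->
  (k%:R - 1) * l + (split_t k m)%:R * k%:R <= l ^+ 2.
Proof.
move=> k0 l0 /(@rayleigh_split k m (fun=> 1) l k0 l0) /=.
rewrite expr1n !sumr_const card_ord; set Xs := (X in _ + X ^+ 2); set t := (split_t k m)%:R => main.
have kp : 0 < k%:R :> algR by rewrite ltr0n.
have Xs0 : 0 <= Xs ^+ 2 by apply: sqr_ge0.
have : l * (k%:R ^+ 2 - k%:R + (t * k%:R ^+ 2 + Xs ^+ 2) / l) <= l * (l * k%:R).
  by rewrite ler_pM2l.
rewrite mulrDr [l * (_ / _)]mulrCA divff ?gt_eqF // mulr1 => h.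
rewrite -(ler_pM2r kp); move: h Xs0; lra.
Qed.

Lemma perron_normalised n (G : rel 'I_n) : (0 < n)%N -> symmetric G ->
  exists (x : 'I_n -> algR) (u : 'I_n), [/\ forall v, 0 <= x v, forall v, x v <= 1, x u = 1
    & forall v, \sum_w (G v w)%:R * x w = lambdaR G * x v].
Proof.
move=> n0 symG; have [z [z0 [i0 zi0] zE]] := perron_graph n0 symG.
have [u _ umax] := @arg_maxP _ algR 'I_n i0 xpredT z isT.
have zu : 0 < z u by apply: lt_le_trans (umax i0 isT); rewrite lt_def zi0 z0.
exists (fun v => z v / z u), u; split=> [v|v||v].
- by rewrite divr_ge0 // ltW.
- by rewrite ler_pdivrMr // mul1r; apply: umax.
- by rewrite divff // gt_eqF.
by rewrite mulrA -zE mulr_suml; apply: eq_bigr => w _; rewrite mulrA.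
Qed.

Local Close Scope ring_scope.

Theorem theorem1p12 (r p q k : nat) :
  1 <= r -> r <= p -> p <= q ->
  (chromatic_number (theta r p q) 3 /\ 2 <= k /\
     (r + p + q - 1 = 2 * k + 1 \/ r + p + q - 1 = 2 * k + 2))
  \/
  (chromatic_number (theta r p q) 2 /\ 1 <= k /\
     (r + p + q - 1 = 2 * k + 2 \/ r + p + q - 1 = 2 * k + 3)) ->
  exists M : nat, forall m : nat, M <= m ->
    forall (n : nat) (G : rel 'I_n),
      simple_graph G -> nedges G = m -> free_of (theta r p q) G ->
      (lambda G <= lambda (split_graph k m))%R /\
      (lambda G = lambda (split_graph k m) <->
         iso_up_to_isolated G (split_graph k m)).
Proof.
Local Open Scope ring_scope.
move=> r0 rp pq hyp.
have p0 : (0 < p)%N by apply: leq_trans rp.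
have q0 : (0 < q)%N by apply: leq_trans pq.
have k0 : (0 < k)%N by case: hyp => -[_ []]; clear; lia.
(* Chosen so that [m <= k * t + c], the remainder [s] being less than [k]. *)
pose c := ('C(k, 2) + k)%N.
have [L HL] := @hub_structure_large algR (r + p + q + 2) k c k0.
(* [L ^ 2 + c] will force [L <= l], and [2 * k] ensures [2 <= t]. *)
exists (L ^ 2 + c + 2 * k)%N => m Mm n G simG mG freeG; have [symG irrG] := simG.
(* A strictly larger spectral radius would give an isomorphism, hence equality; so [key] yields both
   the bound and its equality case. *)
suff key : lambdaR (split_graph k m) <= lambdaR G -> iso_up_to_isolated G (split_graph k m).
  have isoE := lambda_iso symG (@split_graph_sym k m).
  split; last first.
    split=> [E|/isoE //]; apply: key.
    by have -> : lambdaR G = lambdaR (split_graph k m) by exact: val_inj.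
  have [//|lt] := leP (lambdaR G) (lambdaR (split_graph k m)).
  by have /isoE -> := key (ltW lt).
move=> leS; set l := lambdaR G in leS.
set t := split_t k m; set s := split_s k m.
have Ckm : ('C(k, 2) <= m)%N by rewrite /c in Mm; clear - Mm; lia.
have sk : (s < k)%N by rewrite ltn_mod.
have m2 := split_edges Ckm; rewrite -/t -/s in m2.
have kk1 : (k * (k - 1) = 2 * 'C(k, 2))%N by rewrite subn1 -(bin1 k.-1) mul_bin_diag.
have t2 : (2 <= t)%N.
  have : (2 * k <= m - 'C(k, 2))%N by rewrite /c in Mm; clear - Mm; lia.
  by rewrite /t /split_t leq_divRL.
have kR : 1 <= k%:R :> algR by rewrite ler1n.
have tkR : 2 <= t%:R * k%:R :> algR.
  by rewrite -natrM (ler_nat _ 2); apply: leq_trans t2 _; rewrite leq_pmulr.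
(* If [l < 1], then 1 also bounds the spectral radius of the split graph, and [split_lambda_ge] at 1
   contradicts [2 <= t * k]. *)
have l1 : 1 <= l.
  rewrite leNgt; apply/negP => lt1.
  have := @split_lambda_ge k m 1 k0 ltr01 (le_trans leS (ltW lt1)); rewrite -/t.
  by move: tkR kR; lra.
have l0 : 0 < l by apply: lt_le_trans l1.
have l2 := split_lambda_ge k0 l0 leS; rewrite -/t in l2.
have sumE : (\sum_v \sum_w G v w = 2 * m)%N by rewrite sum_adj_nedges // mG.
have sumR : \sum_v \sum_w (G v w)%:R = 2 * m%:R :> algR.
  rewrite -[RHS](natrM _ 2) -sumE natr_sum; apply: eq_bigr => v _; by rewrite natr_sum.
have lam2 : 2^-1 * \sum_v \sum_w (G v w)%:R + (k%:R - 1) * l - c%:R <= l ^+ 2.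
  have mc : (m <= k * t + c)%N by rewrite /c; clear - m2 kk1 sk; lia.
  have : m%:R <= k%:R * t%:R + c%:R :> algR by rewrite -natrM -natrD ler_nat.
  by rewrite sumR; move: l2; lra.
have Ll : L%:R <= l.
  have L2 : L%:R ^+ 2 <= l ^+ 2 :> algR.
    have : (L ^ 2 + c)%:R <= m%:R :> algR by rewrite ler_nat; clear - Mm; lia.
    rewrite natrD natrX; have : 0 <= (k%:R - 1) * l by apply: mulr_ge0; move: kR l1; lra.
    by move: lam2; rewrite sumR; lra.
  by move: L2; rewrite ler_sqr ?nnegrE ?ler0n // ltW.
have n0 : (0 < n)%N.
  move: sumE; clear - m2 kk1 t2 k0; case: n G => // G; rewrite big_ord0 => m0.
  have : (0 < k * t)%N by rewrite muln_gt0 k0 (leq_trans _ t2).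
  by move: m0 m2; clearbody t s; clear; lia.
have [x [u [x0 x1 xu xE]]] := perron_normalised n0 symG.
have [_ deg thin] := @theta_free_sparse n G r p q k r0 p0 q0 simG freeG hyp.
have [B [dl [eps [[cB xB xnB] [dl0 eps0 dls epss lL]]]]] :=
  HL _ G x l u symG irrG x0 x1 xu xE deg thin lam2 Ll.
(* The hub entries of [x] are placed on the clique in an arbitrary order, since all of them are
   close to 1. *)
pose y i := x (nth u (enum B) i).
have XE : \sum_(i < k) y i = \sum_(a in B) x a by rewrite (sum_nth_enum u) cB.
have X2E : \sum_(i < k) y i ^+ 2 = \sum_(a in B) x a ^+ 2.
  by rewrite (sum_nth_enum u) cB.
pose Xs := \sum_(i < k | (i < s)%N) y i.
have ray : (\sum_(a in B) x a) ^+ 2 - \sum_(a in B) x a ^+ 2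
    + (t%:R * (\sum_(a in B) x a) ^+ 2 + Xs ^+ 2) / l <= l * \sum_(a in B) x a ^+ 2.
  by rewrite -XE -X2E; apply: rayleigh_split.
have Xs_ge : s%:R * (1 - dl) <= Xs.
  rewrite /Xs (big_ord_narrow (ltnW sk)) /=.
  rewrite mulr_natl -[s in leLHS]card_ord -sumr_const; apply: ler_sum => i _.
  apply: xB; rewrite /y -mem_enum mem_nth // -cardE cB.
  exact: ltn_trans (ltn_ord i) sk.
rewrite -cB in k0 dls epss lL.
have m_eq : (\sum_v \sum_w G v w = #|B| * (#|B| - 1) + 2 * (#|B| * t + s))%N by rewrite cB sumE.
have sB : (s < #|B|)%N by rewrite cB.
have [d0 o0 fc p1 p2] := @hub_rigid _ G B symG irrG algR x l dl eps t s Xs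
  x0 x1 xE k0 xB xnB m_eq sB Xs_ge ray dl0 eps0 dls epss lL.
rewrite cB in k0.
apply: (@hub_iso n G k m B) => //.
exact: leq_trans t2.
Qed.
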